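(* Let $n\ge1$, $G=SO_{2n}$, and let $B,P,L\subset G$ be as in the context. Let $C_I\subset G/P$ be the Schubert cell corresponding to $I\subset[2n]$, and let $\pi:G/L\to G/P$ be the natural projection. Associate to $I$ the matchless clan $\gamma_I=c_1\cdots c_{2n}$ with $c_i=+$ if $i\in I$ and $c_i=-$ if $i\notin I$, and let $\Sigma_I$ denote the set of $DIII$ $(n,n)$-clans whose base clan is $\gamma_I$. If $R_\gamma$ denotes the $B$-orbit of $G/L$ associated to the $DIII$ $(n,n)$-clan $\gamma$, then $$\pi^{-1}(C_I)=\bigsqcup_{\gamma\in\Sigma_I}R_\gamma .$$
   Context: Groups (over $\mathbb C$). $J_{m}$ is the $m\times m$ matrix with 1's on the antidiagonal and 0's elsewhere. $G=SO_{2n}=\{g\in SL_{2n}: g^tJ_{2n}g=J_{2n}\}$; $B$ is the subgroup of upper triangular matrices in $G$; $P\subset G$ is the stabilizer of $E_n=\mathrm{span}(\mathbf e_1,\dots,\mathbf e_n)$ (matrices whose lower left $n\times n$ block is $0$); $L=\{\mathrm{diag}(A,\,J_n(A^{-1})^tJ_n): A\in GL_n\}\subset P$. Put $\tilde E_n=\mathrm{span}(\mathbf e_{n+1},\dots,\mathbf e_{2n})$. Schubert cells. $G/P$ is identified with the $G$-orbit of $E_n$ in the set of maximal isotropic subspaces of $\mathbb C^{2n}$ (with respect to $J_{2n}$) via $gP\mapsto gE_n$. Its $B$-orbits (Schubert cells) $C_I$ are indexed by the subsets $I\subset[2n]=\{1,\dots,2n\}$ with $|I|=n$, such that $i\in I$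 implies $2n+1-i\notin I$, and such that $|[n]\setminus I|$ is even; $C_I$ is the $B$-orbit of $\mathrm{span}\{\mathbf e_i: i\in I\}$. Clans. An $(n,n)$-clan is a string $\gamma=c_1\cdots c_{2n}$ of symbols from $\mathbb N\cup\{+,-\}$ with equally many $+$'s and $-$'s, in which every natural number that appears appears exactly twice; two clans are equal if they have the same signs at the same positions and the same positions of matching number pairs. $rev(\gamma)=c_{2n}\cdots c_1$, and $\overline\gamma$ is obtained by exchanging $+$ and $-$. A $DIII$ $(n,n)$-clan is an $(n,n)$-clan such that (i) $\gamma=rev(\overline\gamma)$; (ii) if $c_i\in\mathbb N$ then $c_i\ne c_{2n+1-i}$; (iii) the number of $-$'s among $c_1,\dots,c_n$ plus the number of pairs $i<j\le n$ with $c_i=c_j\in\mathbb N$ is even. A clan is matchless if it contains no natural numbers. The base clan of $\gamma$ is the matchless clan obtained by replacing, for each pair $c_i=c_j\in\mathbb N$ with $i<j$, the symbol $c_i$ by $-$ and the symbol $c_j$ by $+$. Orbits. $gB\in G/B$ is identified with the full flag $V_\bullet$ whose $i$-th space is spanned by the first $i$ columns of $g$. For a $DIII$ clan $\gamma$, $Q_\gamma\subset G/B$ is the set of flags $V_\bullet\in G/B$ such that for all $i$ and all $i<j$: $\dim(V_i\cap E_n)$ is the number of $+$'s plus the number of completed matching pairs (both members) among $c_1,\dots,c_i$; $\dim(V_i\cap\tilde E_n)$ is the number of $-$'s plus the number of completed matching pairs among $c_1,\dots,c_i$; and $\dim(\mathrm{pr}(V_i)+V_j)=j+\#\{(s,t):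 c_s=c_t\in\mathbb N,\ s\le i<j<t\}$, where $\mathrm{pr}:\mathbb C^{2n}\to E_n$ is the projection with kernel $\tilde E_n$. It is known that $\gamma\mapsto Q_\gamma$ is a bijection from $DIII$ $(n,n)$-clans to $L$-orbits in $G/B$. The corresponding $B$-orbit in $G/L$ is $R_\gamma=\{gL: g^{-1}B\in Q_\gamma\}$. *)

(* Defs.v *)
From HB Require Import structures.
From mathcomp Require Import all_boot all_order all_algebra.
From mathcomp Require Import classical_sets reals.
From mathcomp Require Export complex.
Set Implicit Arguments.
Unset Strict Implicit.
Unset Printing Implicit Defensive.
Import GRing.Theory.
Local Open Scope ring_scope.

(* Indices are 0-based: the position k of [2n] is the element k-1 of           *)
(* 'I_(n + n), so 2n+1-k corresponds to rev_ord and "k <= i" to (k < i)%N.     *)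

Section Groups.
Variables (F : fieldType) (n : nat).

Definition antidiag (m : nat) : 'M[F]_m := \matrix_(i, j) (j == rev_ord i)%:R.

Definition standard_span (S : {set 'I_(n + n)}) : {vspace 'cV[F]_(n + n)} :=
  <<[seq delta_mx i 0%R | i in S]>>%VS.

Definition En : {vspace 'cV[F]_(n + n)} := standard_span [set i : 'I_(n + n) | (i < n)%N].
Definition Entilde : {vspace 'cV[F]_(n + n)} := standard_span [set i : 'I_(n + n) | (n <= i)%N].

Definition translate (g : 'M[F]_(n + n)) (V : {vspace 'cV[F]_(n + n)}) :
  {vspace 'cV[F]_(n + n)} := (linfun (mulmx g) @: V)%VS.

Definition SO : set 'M[F]_(n + n) :=
  [set g | \det g = 1 /\ g^T *m antidiag _ *m g = antidiag _]%classic.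

Definition Borel : set 'M[F]_(n + n) :=
  [set g | SO g /\ forall i j : 'I_(n + n), (j < i)%N -> g i j = 0]%classic.

Definition Parabolic : set 'M[F]_(n + n) :=
  [set g | SO g /\ translate g En = En]%classic.

Definition Levi : set 'M[F]_(n + n) :=
  [set block_mx A 0 0 (antidiag n *m (invmx A)^T *m antidiag n)
    | A in [set A : 'M[F]_n | A \in unitmx]]%classic.

Definition left_coset (g : 'M[F]_(n + n)) (H : set 'M[F]_(n + n)) :
  set 'M[F]_(n + n) := [set g *m h | h in H]%classic.

Definition quotient_SO (H : set 'M[F]_(n + n)) : set (set 'M[F]_(n + n)) :=
  [set left_coset g H | g in SO]%classic.

(* The projection G/L -> G/P; it sends gL to gP because (gL)P = gP.            *)
Definition proj_LP (X : set 'M[F]_(n + n)) : set 'M[F]_(n + n) :=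
  [set x *m p | x in X & p in Parabolic]%classic.

(* G/P is identified with the G-orbit of E_n by gP |-> g E_n.                  *)
Definition schubert_cell (I : {set 'I_(n + n)}) : set (set 'M[F]_(n + n)) :=
  [set left_coset g Parabolic | g in
    [set g | SO g /\ exists2 b, Borel b &
                     translate g En = translate b (standard_span I)]]%classic.

Definition flag (g : 'M[F]_(n + n)) (i : nat) : {vspace 'cV[F]_(n + n)} :=
  <<[seq col k g | k : 'I_(n + n) <- enum 'I_(n + n) & (k < i)%N]>>%VS.

End Groups.

Arguments En : clear implicits.
Arguments Entilde : clear implicits.
Arguments SO : clear implicits.
Arguments Borel : clear implicits.
Arguments Parabolic : clear implicits.
Arguments Levi : clear implicits.
Arguments proj_LP : clear implicits.
Arguments schubert_cell F {n} I : rename.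

Definition schubert_index (n : nat) (I : {set 'I_(n + n)}) : Prop :=
  [/\ #|I| = n,
      forall i, i \in I -> rev_ord i \notin I
    & ~~ odd #|[set i : 'I_(n + n) | (i < n)%N] :\: I|].

Inductive symbol := SPlus | SMinus | SNat of nat.

Definition symbol_code (s : symbol) : bool + nat :=
  match s with SPlus => inl true | SMinus => inl false | SNat k => inr k end.
Definition symbol_decode (s : bool + nat) : symbol :=
  match s with inl true => SPlus | inl false => SMinus | inr k => SNat k end.
Lemma symbol_codeK : cancel symbol_code symbol_decode. Proof. by case. Qed.
HB.instance Definition _ := Equality.copy symbol (can_type symbol_codeK).

Definition is_nat_symbol (s : symbol) : bool :=
  if s is SNat _ then true else false.

Definition opp_symbol (s : symbol) : symbol :=
  match s with SPlus => SMinus | SMinus => SPlus | SNat k => SNat k end.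

Section Clans.
Variable n : nat.
Implicit Types c d : {ffun 'I_(n + n) -> symbol}.

Definition is_clan c : Prop :=
  #|[set i | c i == SPlus]| = #|[set i | c i == SMinus]| /\
  forall i, is_nat_symbol (c i) -> #|[set j | c j == c i]| = 2%N.

(* i < j is a pair of positions carrying the same natural number.              *)
Definition matching c (i j : 'I_(n + n)) : bool :=
  [&& is_nat_symbol (c i), c j == c i & (i < j)%N].

(* Equality of clans: strings up to renaming of the natural numbers.           *)
Definition clan_eq c d : Prop :=
  [/\ forall i, (c i == SPlus) = (d i == SPlus),
      forall i, (c i == SMinus) = (d i == SMinus)
    & forall i j, matching c i j = matching d i j].

Definition clan_rev c : {ffun 'I_(n + n) -> symbol} :=
  [ffun i => c (rev_ord i)].
Definition clan_opp c : {ffun 'I_(n + n) -> symbol} :=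
  [ffun i => opp_symbol (c i)].

Definition is_DIII c : Prop :=
  [/\ is_clan c,
      clan_eq c (clan_rev (clan_opp c)),
      forall i, is_nat_symbol (c i) -> c i <> c (rev_ord i)
    & ~~ odd (#|[set i : 'I_(n + n) | (c i == SMinus) && (i < n)%N]| +
              #|[set p : 'I_(n + n) * 'I_(n + n) |
                  matching c p.1 p.2 && (p.2 < n)%N]|)].

Definition base_clan c : {ffun 'I_(n + n) -> symbol} :=
  [ffun i => if [exists j, matching c i j] then SMinus
             else if [exists j, matching c j i] then SPlus
             else c i].

Definition clan_of_index (I : {set 'I_(n + n)}) : {ffun 'I_(n + n) -> symbol} :=
  [ffun i => if i \in I then SPlus else SMinus].

(* No quotient by clan_eq is needed to compare base clans: matchless strings   *)
(* are equal as clans only if they are equal.                                  *)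
Definition Sigma (I : {set 'I_(n + n)}) : set {ffun 'I_(n + n) -> symbol} :=
  [set c | is_DIII c /\ base_clan c = clan_of_index I]%classic.

Definition nb_plus c (i : nat) : nat :=
  #|[set k : 'I_(n + n) | (c k == SPlus) && (k < i)%N]|.
Definition nb_minus c (i : nat) : nat :=
  #|[set k : 'I_(n + n) | (c k == SMinus) && (k < i)%N]|.
Definition nb_completed c (i : nat) : nat :=
  #|[set p : 'I_(n + n) * 'I_(n + n) | matching c p.1 p.2 && (p.2 < i)%N]|.
(* Pairs (s, t) with s <= i < j < t in 1-based positions.                      *)
Definition nb_spanning c (i j : nat) : nat :=
  #|[set p : 'I_(n + n) * 'I_(n + n) |
      [&& matching c p.1 p.2, (p.1 < i)%N & (j <= p.2)%N]]|.

Variable F : fieldType.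

Definition flag_in_clan c (V : nat -> {vspace 'cV[F]_(n + n)}) : Prop :=
  [/\ forall i, (1 <= i <= n + n)%N ->
        \dim (V i :&: En F n) = (nb_plus c i + nb_completed c i)%N,
      forall i, (1 <= i <= n + n)%N ->
        \dim (V i :&: Entilde F n) = (nb_minus c i + nb_completed c i)%N
    & forall i j, (1 <= i)%N -> (i < j)%N -> (j <= n + n)%N ->
        \dim (daddv_pi (En F n) (Entilde F n) @: V i + V j)
          = (j + nb_spanning c i j)%N].

(* A coset gB is identified with the flag of spans of the first columns of g.  *)
Definition orbit_Q c : set (set 'M[F]_(n + n)) :=
  [set left_coset g (Borel F n)
    | g in [set g | SO F n g /\ flag_in_clan c (flag g)]]%classic.

Definition orbit_R c : set (set 'M[F]_(n + n)) :=
  [set left_coset g (Levi F n)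
    | g in [set g | SO F n g /\ orbit_Q c (left_coset (invmx g) (Borel F n))]]%classic.

End Clans.

Arguments orbit_Q {n} F c : rename.
Arguments orbit_R {n} F c : rename.

(* Main.v *)
(* Let pr be the projection onto E_n along Ẽ_n. For a flag V, say that a subspace U jumps at s
   if V_(s+1) contains a vector of U outside V_s, so that dim (V_i ∩ U) counts the jumps of U
   below i. Every flag has a clan: s is + or - if exactly one of E_n, Ẽ_n jumps at s, a left end
   if neither does, a right end if both do, and a left end s is matched with the t such that
   pr^-1(V_(t+1)) jumps at s but pr^-1(V_t) does not. All the dimensions defining Q_γ are jump
   counts. If V is isotropic, V_i is the orthogonal of V_(2n-i) and the adjoint of pr is 1 - pr,
   which gives the symmetry of a DIII clan; its parity condition says that dim (g E_n ∩ Ẽ_n) is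
   even for g in SO_2n.
   For V = g^-1 F, with F the standard flag, E_n jumps exactly at the + of the base clan; these
   jumps are also those of g E_n along F, which determine its Schubert cell. *)
Require Import Defs.
From mathcomp Require Import all_boot all_order all_fingroup all_algebra.
From mathcomp Require Import complex zify.
Set Implicit Arguments.
Unset Strict Implicit.
Unset Printing Implicit Defensive.
Import Order.TTheory GRing.Theory Num.Theory.
Local Open Scope ring_scope.

(** * Jumps of a subspace along a flag *)

(** Covering needs a clan for every flag; disjointness needs a clan to be recoverable from its
    numbers. The two are proved separately, and the pairs are the difficulty in both. By
    rank-nullity, dim (pr V_i + V_j) = i + j - dim (V_i ∩ pr^-1 V_j), which is why the third family
    of dimensions also counts jumps: its excess over j is the number of s < i at which pr^-1 V_j
    does not jump. Conversely a pair is a mixed second difference of the third family, but this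
    family is given only for i < j, so pairs of adjacent positions escape; they are recovered
    because the first two families already tell which positions are left ends. Among the conditions
    of a DIII clan, parity is the one that the form alone does not give: it uses det g = 1. That 2
    is nonzero serves twice, to exclude a pair symmetric to itself and to distinguish the sign of a
    permutation from 1. *)

Section Jumps.
Variables (F : fieldType) (vT : vectType F) (V : nat -> {vspace vT}) (N : nat).
Hypothesis V_sub : forall i j, (i <= j)%N -> (V i <= V j)%VS.
Hypothesis dimV : forall i, (i <= N)%N -> \dim (V i) = i.
Implicit Types (U : {vspace vT}) (f : 'End(vT)) (s t i j : nat).

Definition jump U s := (\dim (V s :&: U) < \dim (V s.+1 :&: U))%N.

Lemma jumpP U s :
  reflect (exists v, [/\ v \in V s.+1, v \in U & v \notin V s]) (jump U s).
Proof.
have sub : (V s :&: U <= V s.+1 :&: U)%VS by rewrite capvS // V_sub.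
rewrite /jump ltn_neqAle dimvS // andbT (dimv_leqif_sup sub).
apply: (iffP (@subvPn _ _ (V s.+1 :&: U)%VS (V s :&: U)%VS)) => [[v] | [v [vV vU vs]]].
  rewrite !memv_cap => /andP[vV vU]; rewrite vU andbT => vs.
  by exists v.
by exists v; rewrite memv_cap ?vV ?vU // (negPf vs).
Qed.

(** [V s] has codimension one in [V s.+1], so a single vector outside [V s] spans the quotient. This
    is the elimination step of most arguments on jumps. *)
Lemma flag_scale s u v : (s < N)%N -> u \in V s.+1 -> u \notin V s ->
  v \in V s.+1 -> exists a, v - a *: u \in V s.
Proof.
move=> sN uV us vV.
have E : (V s + <[u]>)%VS = V s.+1.
  apply/eqP; rewrite eqEdim subv_add V_sub // -memvE uV /= dimV //.
  have sub : (V s <= V s + <[u]>)%VS by rewrite addvSl.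
  rewrite -[X in (X < _)%N](dimV (ltnW sN)) ltn_neqAle dimvS // andbT.
  by rewrite (dimv_leqif_sup sub) subv_add subvv /= -memvE.
move: vV; rewrite -E => /memv_addP [w wV [x /vlineP [a ->] ->]].
by exists a; rewrite addrK.
Qed.

Lemma flag_scale_notin s u v : (s < N)%N -> u \in V s.+1 -> u \notin V s ->
  v \in V s.+1 -> v \notin V s -> exists2 a, a != 0 & v - a *: u \in V s.
Proof.
move=> sN uV us vV vs; have [a Ha] := flag_scale sN uV us vV.
exists a => //; apply: contra vs => /eqP a0.
by move: Ha; rewrite a0 scale0r subr0.
Qed.

Lemma jump_dim U s : (s < N)%N ->
  \dim (V s.+1 :&: U) = (\dim (V s :&: U) + jump U s)%N.
Proof.
move=> sN; case: (boolP (jump U s)) => [/[dup] J | ]; last first.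
  rewrite /jump -leqNgt addn0 => le; apply/eqP; rewrite eqn_leq le /=.
  by rewrite dimvS // capvS // V_sub.
move/jumpP => [u [uV uU us]].
apply/eqP; rewrite eqn_leq; apply/andP; split; last by rewrite addn1.
have sub : (V s.+1 :&: U <= (V s :&: U) + <[u]>)%VS.
  apply/subvP => v; rewrite memv_cap => /andP[vV vU].
  have [a Ha] := flag_scale sN uV us vV.
  rewrite -(subrK (a *: u) v) memv_add ?memvZ ?memv_line //.
  by rewrite memv_cap Ha memvB // memvZ.
apply: leq_trans (dimvS sub) _; apply: leq_trans (dimv_add_leqif _ _) _.
by rewrite dim_vline leq_add2l leq_b1.
Qed.

Lemma dim_jumps U i : (i <= N)%N -> \dim (V i :&: U) = (\sum_(s < i) jump U s)%N.
Proof.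
elim: i => [_|i IH iN]; last by rewrite jump_dim // big_ord_recr IH // ltnW.
have/eqP: \dim (V 0%N) = 0%N by rewrite dimV.
by rewrite dimv_eq0 => /eqP->; rewrite cap0v dimv0 big_ord0.
Qed.

Lemma jumpS U W s : (U <= W)%VS -> jump U s -> jump W s.
Proof.
move=> /subvP UW /jumpP [v [v1 v2 v3]]; apply/jumpP; exists v.
by split=> //; apply: UW.
Qed.

(** The kernel of [f] on [V i] lies in the preimage of [V j], so rank-nullity on [V i] and on
    [V i :&: f @^-1: V j] involves the same kernel, which cancels. *)
Lemma dim_img_add f i j : (i <= N)%N -> (j <= N)%N ->
  (\dim (f @: V i + V j) + \dim (V i :&: f @^-1: V j) = i + j)%N.
Proof.
move=> iN jN.
have := dimv_sum_cap (f @: V i) (V j).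
have K := limg_ker_dim f (V i).
have := limg_ker_dim f (V i :&: f @^-1: V j)%VS.
have -> : (V i :&: f @^-1: V j :&: lker f = V i :&: lker f)%VS.
  apply/vspaceP => v; rewrite !memv_cap -memv_preim memv_ker -andbA; congr andb.
  by case: eqP => [->|]; rewrite ?mem0v ?andbF.
have -> : (f @: (V i :&: f @^-1: V j) = f @: V i :&: V j)%VS.
  apply/vspaceP => w; rewrite memv_cap; apply/memv_imgP/andP.
    move=> [v]; rewrite memv_cap -memv_preim => /andP[vV fv] ->.
    by rewrite memv_img.
  move=> [/memv_imgP [v vV ->] fv]; exists v => //.
  by rewrite memv_cap vV -memv_preim.
rewrite !dimV // in K *; lia.
Qed.

End Jumps.

(** * Matching of the steps of a flag by an idempotent [p] with image [E] and kernel [T] *)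

Section FlagMatching.
Variables (F : fieldType) (vT : vectType F) (V : nat -> {vspace vT}) (N : nat).
Hypothesis V_sub : forall i j, (i <= j)%N -> (V i <= V j)%VS.
Hypothesis dimV : forall i, (i <= N)%N -> \dim (V i) = i.
Hypothesis V_full : V N = fullv.
Variables (p : 'End(vT)) (E T : {vspace vT}).
Hypothesis p_idem : forall v, p (p v) = p v.
Hypothesis memE : forall v, (v \in E) = (p v == v).
Hypothesis memT : forall v, (v \in T) = (p v == 0).
Implicit Types s t i j : nat.

Definition pull j : {vspace vT} := (p @^-1: V j)%VS.

(** [pull j] grows with [j], so [t] is the threshold at which it starts to jump at [s]. The
    condition [s < t] singles out the left ends: [pull s.+1] jumps at [s] exactly when [E] or [T]
    does. *)
Definition flag_matching s t :=
  [&& (s < t)%N, ~~ jump V (pull t) s & jump V (pull t.+1) s].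

Let jumpP := jumpP V_sub.

Lemma jump_pullS j j' s : (j <= j')%N -> jump V (pull j) s -> jump V (pull j') s.
Proof. by move=> jj'; apply: (jumpS V_sub); apply/lpreimS/V_sub. Qed.

Lemma jumpE_pull s j : (s < j)%N -> jump V E s -> jump V (pull j) s.
Proof.
move=> sj /jumpP[v [vV]]; rewrite memE => /eqP pv vs; apply/jumpP.
by exists v; rewrite -memv_preim pv (subvP (V_sub sj)).
Qed.

Lemma jumpT_pull s j : jump V T s -> jump V (pull j) s.
Proof.
move=> /jumpP[v [vV]]; rewrite memT => /eqP pv vs; apply/jumpP.
by exists v; rewrite -memv_preim pv mem0v.
Qed.

(** A witness [v] splits inside [V s.+1] as [p v] plus [v - p v], and one of the two parts must lie
    outside [V s]. *)
Lemma jump_pull_succ s : jump V (pull s.+1) s -> jump V E s || jump V T s.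
Proof.
move=> /jumpP[v [vV]]; rewrite -memv_preim => pv vs.
case: (boolP (p v \in V s)) => pvs; apply/orP; [right | left]; apply/jumpP.
  exists (v - p v); rewrite memT linearB /= p_idem subrr eqxx memvB //.
  split=> //; apply: contra vs => vs.
  by rewrite -(subrK (p v) v) memvD.
by exists (p v); rewrite memE p_idem.
Qed.

Lemma matching_exists_right s : (s < N)%N -> ~~ jump V E s -> ~~ jump V T s ->
  exists2 t, (t < N)%N & flag_matching s t.
Proof.
move=> sN jE jT.
have exN : exists j, jump V (pull j) s.
  exists N; suff -> : pull N = fullv.
    by rewrite /jump !capvf !dimV // ltnW.
  by apply/vspaceP => v; rewrite -memv_preim V_full !memvf.
(* The least [j] is written [t.+1]. Both [j = 0] and [t <= s] would make [pull s.+1] jump at [s],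
   hence [E] or [T]. *)
case: (ex_minnP exN) => -[|t] jt tmin.
  have /jump_pull_succ := jump_pullS (leq0n s.+1) jt.
  by rewrite (negPf jE) (negPf jT).
have tN : (t < N)%N.
  apply: tmin; suff -> : pull N = fullv.
    by rewrite /jump !capvf !dimV // ltnW.
  by apply/vspaceP => v; rewrite -memv_preim V_full !memvf.
exists t => //; rewrite /flag_matching jt andbT; apply/andP; split.
  rewrite ltnNge; apply/negP => ts.
  have /jump_pull_succ : jump V (pull s.+1) s by apply: jump_pullS jt.
  by rewrite (negPf jE) (negPf jT).
by apply/negP => /tmin; rewrite ltnn.
Qed.

Lemma matching_left s t : flag_matching s t -> ~~ jump V E s && ~~ jump V T s.
Proof.
case/and3P => st nj _; apply/andP; split; apply: contra nj => j.
  exact: jumpE_pull.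
exact: jumpT_pull.
Qed.

Lemma matching_witness s t : flag_matching s t ->
  exists v, [/\ v \in V s.+1, v \notin V s, p v \in V t.+1 & p v \notin V t].
Proof.
case/and3P => st nj /jumpP[v [v1 v2 v3]]; exists v; split=> //.
  by rewrite memv_preim.
by apply: contra nj => pv; apply/jumpP; exists v; rewrite -memv_preim.
Qed.

(** The witness [v] of the pair already lies in [V t], while [p v] is new at step [t]; hence [p v]
    and [v - p v] are both new there, one in [E], the other in [T]. *)
Lemma matching_right s t : flag_matching s t -> jump V E t && jump V T t.
Proof.
move=> M; have [v [v1 v2 v3 v4]] := matching_witness M.
have st : (s < t)%N by case/and3P: M.
have vt : v \in V t by apply: (subvP (V_sub st)).
apply/andP; split; apply/jumpP.
  by exists (p v); rewrite memE p_idem eqxx.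
exists (v - p v); rewrite memT linearB /= p_idem subrr eqxx.
rewrite memvB // ?(subvP (V_sub (leqnSn t))) //; split=> //.
by apply: contra v4 => vpv; rewrite -(subKr v (p v)) memvB.
Qed.

(** Vectors of [E] and of [T] that are new at [t] have a combination [v' - a *: v] in [V t], with
    [a] nonzero, whose image [- a *: v] is new at [t]. The partner is the first step of the flag at
    which a vector of [pull t.+1] outside [pull t] appears. *)
Lemma matching_exists_left t : (t < N)%N -> jump V E t -> jump V T t ->
  exists s, flag_matching s t.
Proof.
move=> tN /jumpP[v [vV]]; rewrite memE => /eqP pv vt.
move=> /jumpP[v' [vV']]; rewrite memT => /eqP pv' vt'.
have [a a0 aV] := flag_scale_notin V_sub dimV tN vV vt vV' vt'.
have exk : exists k, ~~ (V k :&: pull t.+1 <= pull t)%VS.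
  exists t; apply/negP => /subvP /(_ (v' - a *: v)).
  rewrite memv_cap aV -!memv_preim linearB linearZ /= pv pv' sub0r !memvN.
  rewrite memvZ // => /(_ isT) avt; case/negP: vt.
  by rewrite -(scalerK a0 v) memvZ.
case: (ex_minnP exk) => -[|s].
  rewrite (_ : V 0%N = 0%VS) ?cap0v ?sub0v //.
  by apply/eqP; rewrite -dimv_eq0 dimV.
move=> /subvPn[w]; rewrite memv_cap => /andP[wV wp] wt smin; exists s.
have st : (s < t)%N.
  apply: smin; apply/negP => /subvP /(_ (v' - a *: v)).
  rewrite memv_cap aV -!memv_preim linearB linearZ /= pv pv' sub0r !memvN.
  rewrite memvZ // => /(_ isT) avt; case/negP: vt.
  by rewrite -(scalerK a0 v) memvZ.
have below : (V s :&: pull t.+1 <= pull t)%VS.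
  by apply/negPn/negP => /smin; rewrite ltnn.
have ws : w \notin V s.
  apply: contra wt => ws; apply: (subvP below).
  by rewrite memv_cap ws.
apply/and3P; split=> //; last by apply/jumpP; exists w.
(* If [w'] in [pull t] were new at [s], reducing [w] by it would give a vector of [V s] in
   [pull t.+1], hence in [pull t] by minimality of [s]; then [w] would lie in [pull t] too. *)
apply/negP => /jumpP[w' [w1 w2 w3]].
have [b bV] := flag_scale V_sub dimV (ltn_trans st tN) w1 w3 wV.
have tt : (pull t <= pull t.+1)%VS by apply/lpreimS/V_sub.
case/negP: wt; rewrite -(subrK (b *: w') w) memvD ?memvZ //.
apply: (subvP below); rewrite memv_cap bV memvB // memvZ //.
exact: (subvP tt).
Qed.

Lemma matching_fun s t t' : flag_matching s t -> flag_matching s t' -> t = t'.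
Proof.
wlog lt : t t' / (t < t')%N => [W M M' | ].
  case: (ltngtP t t') => // lt; first exact: W.
  by apply/esym/W.
move=> /and3P[_ _ j] /and3P[_ nj _].
by case/negP: nj; apply: jump_pullS j.
Qed.

(** If [s < s'] had the same partner, subtracting a multiple of the witness of [s] from that of [s']
    would bring its image into [V t] and keep it new at [s'], so [pull t] would jump at [s']. *)
Lemma matching_inj s s' t : (t < N)%N ->
  flag_matching s t -> flag_matching s' t -> s = s'.
Proof.
move=> tN; wlog lt : s s' / (s < s')%N => [W M M' | ].
  case: (ltngtP s s') => // lt; first exact: W.
  by apply/esym/W.
move=> M M'.
have [v [v1 v2 v3 v4]] := matching_witness M.
have [w [w1 w2 w3 w4]] := matching_witness M'.
have [a aV] := flag_scale V_sub dimV tN v3 v4 w3.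
case/and3P: M' => _ /negP[]; apply/jumpP; exists (w - a *: v).
rewrite -memv_preim.
have vs' : v \in V s' by apply: (subvP (V_sub lt)).
have -> : p (w - a *: v) = p w - a *: p v by rewrite linearB linearZ.
rewrite aV memvB //; last first.
  by rewrite memvZ // (subvP (V_sub (leqnSn s'))).
split=> //; apply: contra w2 => wv.
by rewrite -(subrK (a *: v) w) memvD // memvZ.
Qed.

End FlagMatching.

Lemma card_set_sum (X : finType) (P : pred X) :
  #|[set x | P x]| = (\sum_x (P x : nat))%N.
Proof. by rewrite -sum1dep_card big_mkcond. Qed.

Lemma sum_ord_widen (N i : nat) (f : nat -> bool) : (i <= N)%N ->
  (\sum_(s < i) f s)%N = (\sum_(s < N) (f s && (s < i)))%N.
Proof.
move=> iN; rewrite (big_ord_widen N (fun s => f s : nat) iN) big_mkcond.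
by apply: eq_bigr => s _; case: (s < i)%N; rewrite ?andbT ?andbF.
Qed.

(** * The clan of a flag *)

Section ClanOfFlag.
Variables (F : fieldType) (vT : vectType F) (V : nat -> {vspace vT}) (n : nat).
Hypothesis V_sub : forall i j, (i <= j)%N -> (V i <= V j)%VS.
Hypothesis dimV : forall i, (i <= n + n)%N -> \dim (V i) = i.
Hypothesis V_full : V (n + n) = fullv.
Variables (p : 'End(vT)) (E T : {vspace vT}).
Hypothesis p_idem : forall v, p (p v) = p v.
Hypothesis memE : forall v, (v \in E) = (p v == v).
Hypothesis memT : forall v, (v \in T) = (p v == 0).
Implicit Types s t : 'I_(n + n).

Let M := flag_matching V p.

(** A left end carries its own position as its number, a right end the position of its partner. The
    default [s] is never taken, since [matching_exists_left] provides the partner. *)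
Definition clan_of_flag : {ffun 'I_(n + n) -> symbol} :=
  [ffun s : 'I_(n + n) =>
    if jump V E s then
      if jump V T s then SNat (odflt s [pick r : 'I_(n + n) | M r s]) else SPlus
    else if jump V T s then SMinus else SNat s].

Lemma clan_of_flag_plus s :
  (clan_of_flag s == SPlus) = jump V E s && ~~ jump V T s.
Proof. by rewrite ffunE; case: jump; case: jump. Qed.

Lemma clan_of_flag_minus s :
  (clan_of_flag s == SMinus) = ~~ jump V E s && jump V T s.
Proof. by rewrite ffunE; case: jump; case: jump. Qed.

Lemma clan_of_flag_nat s :
  is_nat_symbol (clan_of_flag s) = (jump V E s == jump V T s).
Proof. by rewrite ffunE; case: jump; case: jump. Qed.

Lemma flag_matching_left_ord s : ~~ jump V E s -> ~~ jump V T s ->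
  exists t : 'I_(n + n), M s t.
Proof.
move=> jE jT.
have [t tN st] := matching_exists_right V_sub dimV V_full p_idem memE memT (ltn_ord s) jE jT.
by exists (Ordinal tN).
Qed.

Lemma clan_of_flag_right s : jump V E s -> jump V T s ->
  exists2 r : 'I_(n + n), M r s & clan_of_flag s = SNat r.
Proof.
move=> jE jT; rewrite ffunE jE jT; case: pickP => [r rs | no]; first by exists r.
have [r rs] := matching_exists_left V_sub dimV memE memT (ltn_ord s) jE jT.
have rN : (r < n + n)%N by case/and3P: rs => lt _ _; apply: ltn_trans lt _.
by move: (no (Ordinal rN)); rewrite /M /= rs.
Qed.

Lemma matching_clan_of_flag s t : matching clan_of_flag s t = M s t.
Proof.
have L (r : 'I_(n + n)) : ~~ jump V E r -> ~~ jump V T r -> clan_of_flag r = SNat r.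
  by move=> /negPf e /negPf f; rewrite ffunE e f.
apply/and3P/idP => [[] | st].
  rewrite clan_of_flag_nat => /eqP es /eqP ec st.
  have := clan_of_flag_nat s; rewrite -ec clan_of_flag_nat es eqxx => /eqP et.
  (* Only a left end before a right end is possible. Two right ends would share a partner, a right
     end [s] carries a number below [s], and distinct left ends carry distinct numbers. *)
  case: (boolP (jump V T s)) => js; case: (boolP (jump V T t)) => jt.
  - have [r rs er] := clan_of_flag_right (etrans es js) js.
    have [r' rt er'] := clan_of_flag_right (etrans et jt) jt.
    have rr : nat_of_ord r = r' by move: ec; rewrite er er' => -[].
    move: st; rewrite (matching_fun V_sub (t := s) (t' := t) rs) ?ltnn //.
    by rewrite rr.
  - have [r rs er] := clan_of_flag_right (etrans es js) js.
    have rt : nat_of_ord r = t by move: ec; rewrite er L ?et // => -[].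
    by case/and3P: rs => lt _ _; lia.
  - have [r rt er] := clan_of_flag_right (etrans et jt) jt.
    have rs : nat_of_ord r = s by move: ec; rewrite er L ?es // => -[].
    by rewrite /M -rs.
  - have e : nat_of_ord t = s by move: ec; rewrite !L ?es ?et // => -[].
    by move: st; rewrite e ltnn.
have lt : (s < t)%N by case/and3P: st.
have /andP[s1 s2] := matching_left V_sub memE memT st.
have /andP[t1 t2] := matching_right V_sub p_idem memE memT st.
have [r rt er] := clan_of_flag_right t1 t2.
have rs := matching_inj V_sub dimV (ltn_ord t) rt st.
by rewrite (L _ s1 s2) er rs eqxx.
Qed.

Lemma nb_completed_clan_of_flag i :
  nb_completed clan_of_flag i =
  (\sum_(t < n + n) [&& jump V E t, jump V T t & (t < i)%N])%N.
Proof.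
rewrite -(card_set_sum (fun t : 'I_(n + n) => [&& jump V E t, jump V T t & (t < i)%N])).
rewrite /nb_completed -(@card_in_imset _ _ snd).
  apply: eq_card => t; rewrite inE; apply/imsetP/and3P.
    move=> [[r t']]; rewrite inE matching_clan_of_flag /= => /andP[rt ti] ->.
    by have /andP[] := matching_right V_sub p_idem memE memT rt.
  move=> [j1 j2 ti]; have [r rt _] := clan_of_flag_right j1 j2.
  by exists (r, t) => //; rewrite inE matching_clan_of_flag rt.
move=> [r t] [r' t']; rewrite !inE !matching_clan_of_flag /=.
move=> /andP[rt _] /andP[rt' _] e; rewrite -{t'}e in rt' *.
by congr pair; apply/val_inj/(matching_inj V_sub dimV (ltn_ord t) rt rt').
Qed.

Lemma nb_plus_clan_of_flag i : (i <= n + n)%N ->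
  (nb_plus clan_of_flag i + nb_completed clan_of_flag i)%N = \dim (V i :&: E).
Proof.
move=> iN; rewrite (dim_jumps V_sub dimV) // (sum_ord_widen _ iN).
rewrite nb_completed_clan_of_flag /nb_plus card_set_sum -big_split /=.
apply: eq_bigr => s _; rewrite clan_of_flag_plus.
by case: (jump V E s); case: (jump V T s); case: (s < i)%N.
Qed.

Lemma nb_minus_clan_of_flag i : (i <= n + n)%N ->
  (nb_minus clan_of_flag i + nb_completed clan_of_flag i)%N = \dim (V i :&: T).
Proof.
move=> iN; rewrite (dim_jumps V_sub dimV) // (sum_ord_widen _ iN).
rewrite nb_completed_clan_of_flag /nb_minus card_set_sum -big_split /=.
apply: eq_bigr => s _; rewrite clan_of_flag_minus.
by case: (jump V E s); case: (jump V T s); case: (s < i)%N.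
Qed.

(** By [dim_img_add] the excess over [j] counts the [s < i] at which [pull j] does not jump. Since
    [i <= j], neither [E] nor [T] jumps at such an [s], so these are the left ends with partner at
    [j] or later. *)
Lemma nb_spanning_clan_of_flag i j : (i <= j)%N -> (j <= n + n)%N ->
  \dim (p @: V i + V j) = (j + nb_spanning clan_of_flag i j)%N.
Proof.
move=> ij jN; have iN := leq_trans ij jN.
have := dim_img_add dimV p iN jN; rewrite (dim_jumps V_sub dimV) //.
suff : (nb_spanning clan_of_flag i j + \sum_(s < i) jump V (p @^-1: V j)%VS s)%N = i.
  by lia.
transitivity (\sum_(s < i) true)%N; last by rewrite sum1_card card_ord.
rewrite !(sum_ord_widen (N := n + n) _ iN) (sum_ord_widen xpredT iN) /=.
have -> : nb_spanning clan_of_flag i j =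
   (\sum_(s < n + n) (~~ jump V (pull V p j) s && (s < i)%N))%N.
  rewrite -(card_set_sum (fun s : 'I_(n + n) => ~~ jump V (pull V p j) s && (s < i)%N)).
  rewrite /nb_spanning -(@card_in_imset _ _ fst).
    apply: eq_card => s; rewrite inE; apply/imsetP/andP.
      move=> [[s' t]]; rewrite inE matching_clan_of_flag /= => /and3P[st si jt] ->.
      split=> //; case/and3P: st => _ nj _.
      by apply: contra nj; apply: jump_pullS.
    move=> [nj si]; have sj := leq_trans si ij.
    have jE : ~~ jump V E s by apply: contra nj; apply: jumpE_pull.
    have jT : ~~ jump V T s by apply: contra nj; apply: jumpT_pull.
    have [t st] := flag_matching_left_ord jE jT.
    exists (s, t) => //; rewrite inE matching_clan_of_flag st si /= leqNgt.
    apply: contra nj => tj; case/and3P: st => _ _ jmp.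
    by apply: jump_pullS jmp.
  move=> [s t] [s' t']; rewrite !inE !matching_clan_of_flag /=.
  move=> /andP[st _] /andP[st' _] e; rewrite -{s'}e in st' *.
  by congr pair; apply/val_inj/(matching_fun V_sub st st').
rewrite -big_split /=; apply: eq_bigr => s _.
by rewrite -/(pull V p j); case: jump; case: (s < i)%N.
Qed.

Lemma card_clan_of_flag_nat s : is_nat_symbol (clan_of_flag s) ->
  #|[set t | clan_of_flag t == clan_of_flag s]| = 2%N.
Proof.
have two (r t : 'I_(n + n)) : M r t -> is_nat_symbol (clan_of_flag r) /\
    [set t' | clan_of_flag t' == clan_of_flag r] = [set r; t].
  move=> rt; have := matching_clan_of_flag r t; rewrite rt => /and3P[nr /eqP e lt].
  split=> //; apply/setP => t'; rewrite !inE.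
  apply/idP/orP => [/eqP e' | [/eqP-> | /eqP->]]; rewrite ?e //.
  case: (ltngtP r t') => [lt' | lt' | /val_inj->]; last by left.
    right; apply/eqP/val_inj/(matching_fun V_sub _ rt).
    by rewrite -/M -matching_clan_of_flag /matching nr e' eqxx.
  have t'r : M t' r by rewrite -matching_clan_of_flag /matching e' nr eqxx.
  have /andP[j _] := matching_right V_sub p_idem memE memT t'r.
  by have /andP[/negP] := matching_left V_sub memE memT rt.
rewrite clan_of_flag_nat => /eqP es.
case: (boolP (jump V T s)) => jT.
  have [r rs _] := clan_of_flag_right (etrans es jT) jT.
  have [_ S] := two _ _ rs.
  have /and3P[_ /eqP-> lt] : matching clan_of_flag r s by rewrite matching_clan_of_flag.
  by rewrite S cards2 neq_ltn lt.
have [|t st] := @flag_matching_left_ord s _ jT; first by rewrite es.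
have [_ ->] := two _ _ st; rewrite cards2 neq_ltn.
by case/and3P: st => ->.
Qed.

(** At the full space the first two families give dim [E] and dim [T] with the same number of pairs,
    so equal dimensions give equally many signs of each kind. *)
Lemma is_clan_clan_of_flag : \dim E = n -> \dim T = n -> is_clan clan_of_flag.
Proof.
move=> dE dT; split; last exact: card_clan_of_flag_nat.
have := nb_plus_clan_of_flag (leqnn _); have := nb_minus_clan_of_flag (leqnn _).
rewrite V_full !capfv dE dT /nb_plus /nb_minus.
have e x : [set k : 'I_(n + n) | (clan_of_flag k == x) && (k < n + n)%N] =
           [set k | clan_of_flag k == x].
  by apply/setP => k; rewrite !inE ltn_ord andbT.
by rewrite !e; lia.
Qed.

End ClanOfFlag.

Lemma prefix_sum_inj (N : nat) (f g : 'I_N -> nat) :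
  (forall i, (1 <= i <= N)%N ->
     (\sum_(s < N | (s < i)%N) f s = \sum_(s < N | (s < i)%N) g s)%N) ->
  f =1 g.
Proof.
move=> fg s.
have D h : (\sum_(r < N | (r < s.+1)%N) h r =
            h s + \sum_(r < N | (r < s)%N) h r)%N.
  rewrite (bigD1 s) //=; congr addn; apply: eq_bigl => r.
  by rewrite -(inj_eq val_inj) ltnS [RHS]ltn_neqAle andbC.
have := fg s.+1; rewrite !D ltn_ord => /(_ isT).
case: (posnP s) => [-> | s0]; first by rewrite !big_pred0_eq !addn0.
by rewrite (fg s) ?s0 ?(ltnW (ltn_ord s)) // => /addIn.
Qed.

(** * Clans and their counting functions *)

Section ClanCounts.
Variable n : nat.
Implicit Types c d : {ffun 'I_(n + n) -> symbol}.

Definition left_end c s := [exists t, matching c s t].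
Definition right_end c t := [exists s, matching c s t].

Lemma is_clan_pair c x y z : is_clan c -> is_nat_symbol (c x) ->
  c y = c x -> c z = c x -> [|| y == x, z == x | y == z].
Proof.
move=> [_ two] nx yx zx; apply: contraT; rewrite !negb_or => /and3P[h1 h2 h3].
have : ([set x; y; z] \subset [set j | c j == c x])%N.
  by apply/fintype.subsetP => j; rewrite !inE => /orP[/orP[]|] /eqP->; rewrite ?yx ?zx.
move/subset_leq_card; rewrite two // -setUA cardsU1 cards2 !inE h3.
by rewrite negb_or !(eq_sym x) h1 h2.
Qed.

Lemma matching_uniq_right c s t t' : is_clan c ->
  matching c s t -> matching c s t' -> t = t'.
Proof.
move=> cl /and3P[ns /eqP e st] /and3P[_ /eqP e' st'].
case/or3P: (is_clan_pair cl ns e e') => /eqP h //.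
  by rewrite h ltnn in st.
by rewrite h ltnn in st'.
Qed.

Lemma matching_uniq_left c s s' t : is_clan c ->
  matching c s t -> matching c s' t -> s = s'.
Proof.
move=> cl /and3P[ns /eqP e st] /and3P[ns' /eqP e' st'].
rewrite e' in e; case/or3P: (is_clan_pair cl ns' (esym e) e') => /eqP h //.
  by rewrite h ltnn in st'.
by rewrite -h ltnn in st.
Qed.

Lemma matching_not_trans c s t u : is_clan c ->
  matching c s t -> matching c t u -> False.
Proof.
move=> cl /and3P[ns /eqP e st] /and3P[_ /eqP e' tu].
case/or3P: (is_clan_pair cl ns e (etrans e' e)) => /eqP h; subst => //; lia.
Qed.

Lemma is_nat_ends c s : is_clan c ->
  is_nat_symbol (c s) = left_end c s (+) right_end c s.
Proof.
move=> cl; case: (boolP (is_nat_symbol (c s))) => ns; last first.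
  rewrite /left_end /right_end.
  case: existsP => [[t /and3P[]] | _]; first by rewrite (negPf ns).
  case: existsP => [[t /and3P[nt /eqP e _]] | //].
  by rewrite e nt in ns.
have /eqP/cards2P[x [y [xy S]]] := cl.2 _ ns.
have [t ts ct] : exists2 t, t != s & c t = c s.
  have := set21 x y; have := set22 x y; rewrite -S !inE => /eqP cy /eqP cx.
  have : s \in [set x; y] by rewrite -S inE.
  rewrite !inE; case/orP => /eqP e; first by exists y; rewrite // e eq_sym.
  by exists x; rewrite // e.
have [st | ts' | /val_inj e] := ltngtP s t; last by rewrite e eqxx in ts.
  have M : matching c s t by rewrite /matching ns ct eqxx.
  have -> : left_end c s by apply/existsP; exists t.
  by apply/esym/existsP => -[r /matching_not_trans /(_ M)]; apply.
have M : matching c t s by rewrite /matching ct ns eqxx.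
have -> : right_end c s by apply/existsP; exists t.
rewrite addbT; apply/esym/existsP => -[r]; exact: matching_not_trans M.
Qed.

Lemma nb_completedE c i : is_clan c ->
  nb_completed c i = (\sum_(t < n + n | (t < i)%N) right_end c t)%N.
Proof.
move=> cl; transitivity (\sum_(t < n + n) (right_end c t && (t < i)) : nat)%N.
  rewrite -(card_set_sum (fun t => right_end c t && (t < i)%N)).
  rewrite /nb_completed -(@card_in_imset _ _ snd).
    apply: eq_card => t; rewrite inE; apply/imsetP/andP.
      move=> [[r t']]; rewrite inE /= => /andP[rt ti] ->.
      by split=> //; apply/existsP; exists r.
    by move=> [/existsP[r rt] ti]; exists (r, t); rewrite // inE rt.
  move=> [r t] [r' t']; rewrite !inE /= => /andP[rt _] /andP[rt' _] e.
  by rewrite -e in rt' *; rewrite (matching_uniq_left cl rt rt').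
rewrite [RHS]big_mkcond; apply: eq_bigr => t _.
by case: right_end; case: (t < i)%N.
Qed.

Lemma nb_plus_completedE c i : is_clan c -> (nb_plus c i + nb_completed c i =
  \sum_(s < n + n | (s < i)%N) ((c s == SPlus) + right_end c s))%N.
Proof.
move=> cl; rewrite nb_completedE // big_split /=; congr addn.
rewrite /nb_plus card_set_sum [RHS]big_mkcond; apply: eq_bigr => t _.
by case: eqP; case: (t < i)%N.
Qed.

Lemma nb_minus_completedE c i : is_clan c -> (nb_minus c i + nb_completed c i =
  \sum_(s < n + n | (s < i)%N) ((c s == SMinus) + right_end c s))%N.
Proof.
move=> cl; rewrite nb_completedE // big_split /=; congr addn.
rewrite /nb_minus card_set_sum [RHS]big_mkcond; apply: eq_bigr => t _.
by case: eqP; case: (t < i)%N.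
Qed.

(** A pair (a, b) contributes to [nb_spanning c i j] when a < i and j <= b, so the mixed second
    difference at (s, t) keeps only a = s, b = t. It is stated without subtraction. *)
Lemma nb_spanning_diff c (s t : 'I_(n + n)) :
  (nb_spanning c s.+1 t + nb_spanning c s t.+1 =
   nb_spanning c s t + nb_spanning c s.+1 t.+1 + matching c s t)%N.
Proof.
have -> : (matching c s t : nat) = (\sum_(q : 'I_(n + n) * 'I_(n + n))
    [&& matching c q.1 q.2, q.1 == s & q.2 == t])%N.
  rewrite (bigD1 (s, t)) //= !eqxx !andbT big1 ?addn0 // => -[a b].
  rewrite xpair_eqE /= => /nandP[] /negPf-> ; by rewrite ?andbF.
rewrite /nb_spanning !card_set_sum -!big_split /=; apply: eq_bigr => -[a b] _ /=.
case: matching => //=; rewrite -!(inj_eq val_inj) /=.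
by lia.
Qed.

Lemma right_end_nat c s : is_clan c -> right_end c s -> is_nat_symbol (c s).
Proof.
move=> cl /existsP[r /and3P[nr /eqP e _]]; by rewrite e.
Qed.

Lemma clan_eq_of_counts c d : is_clan c -> is_clan d ->
  (forall i, (1 <= i <= n + n)%N ->
     (nb_plus c i + nb_completed c i = nb_plus d i + nb_completed d i)%N) ->
  (forall i, (1 <= i <= n + n)%N ->
     (nb_minus c i + nb_completed c i = nb_minus d i + nb_completed d i)%N) ->
  (forall i j, (1 <= i)%N -> (i < j)%N -> (j <= n + n)%N ->
     nb_spanning c i j = nb_spanning d i j) ->
  clan_eq c d.
Proof.
move=> clc cld Hp Hm Hs.
have Ep : forall s, ((c s == SPlus) + right_end c s =
                    (d s == SPlus) + right_end d s)%N.
  apply: prefix_sum_inj => i iN.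
  by rewrite -!nb_plus_completedE // Hp.
have Em : forall s, ((c s == SMinus) + right_end c s =
                    (d s == SMinus) + right_end d s)%N.
  apply: prefix_sum_inj => i iN.
  by rewrite -!nb_minus_completedE // Hm.
(* The increments of the two families at [s] are (1,0) for a plus, (0,1) for a minus, (1,1) for a
   right end and (0,0) for a left end. *)
have types s : [/\ (c s == SPlus) = (d s == SPlus),
    (c s == SMinus) = (d s == SMinus), left_end c s = left_end d s
    & right_end c s = right_end d s].
  have := Ep s; have := Em s.
  have := is_nat_ends s clc; have := is_nat_ends s cld.
  have := @right_end_nat c s clc; have := @right_end_nat d s cld.
  case: (c s) => [||k]; case: (d s) => [||k'] /=; do 4 case: (_ _ s) => //=;
    by do ?[move=> /(_ isT) | move=> _].
(* The counts vanish at [i = 0], which the hypothesis omits but the second difference at [s = 0]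
   uses. *)
have S0 e j : nb_spanning e 0 j = 0%N.
  by apply/eqP; rewrite cards_eq0; apply/eqP/setP => q; rewrite !inE andbF.
have Hs' i j : (i < j)%N -> (j <= n + n)%N -> nb_spanning c i j = nb_spanning d i j.
  by case: i => [|i] ij jN; rewrite ?S0 // Hs.
(* All four corners of the second difference must satisfy i < j, in particular (s.+1, t). *)
have far (s t : 'I_(n + n)) : (s.+1 < t)%N -> matching c s t = matching d s t.
  move=> st; have tN := ltn_ord t.
  have := nb_spanning_diff c s t; have := nb_spanning_diff d s t.
  rewrite !Hs'; try lia.
(* If [t] is adjacent to [s], the partner of [s] in [e'] cannot be far, since it would be the
   partner in [e] as well; so it is adjacent too. The clans [e], [e'] are generic to serve both
   directions. *)
have fit e e' : is_clan e -> is_clan e' ->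
    (forall s, left_end e s = left_end e' s) ->
    (forall s t : 'I_(n + n), (s.+1 < t)%N -> matching e s t = matching e' s t) ->
    forall s t, matching e s t -> matching e' s t.
  move=> cle cle' El far' s t st.
  case: (ltnP s.+1 t) => lt; first by rewrite -far'.
  have : left_end e' s by rewrite -El; apply/existsP; exists t.
  case/existsP => t' st'; case: (ltnP s.+1 t') => lt'.
    by rewrite -far' // in st'; rewrite (matching_uniq_right cle st' st) in lt'; lia.
  suff -> : t = t' by [].
  apply: val_inj; case/and3P: st => _ _; case/and3P: st' => _ _ /=; lia.
split=> [s|s|s t]; try by case: (types s).
apply/idP/idP; apply: fit => // r; try by case: (types r).
by move=> r' rr'; rewrite far.
Qed.

(** The left side of the second condition is the increment at [s] of the first family of dimensions,
    which makes the base clan readable from [En] alone. *)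
Lemma base_clanP c (I : {set 'I_(n + n)}) : is_clan c ->
  base_clan c = clan_of_index I <->
  (forall s, ((c s == SPlus) + right_end c s)%N = (s \in I)).
Proof.
move=> cl; split=> [/ffunP e s | e].
  have := e s; rewrite !ffunE -/(left_end c s) -/(right_end c s).
  have := is_nat_ends s cl; have := @right_end_nat c s cl.
  case: (c s) => [||k]; do 2 case: (_ c s) => //=; case: (s \in I) => //=;
    by do ?[move=> /(_ isT) | move=> ?].
apply/ffunP => s; have := e s; rewrite !ffunE -/(left_end c s) -/(right_end c s).
have := is_nat_ends s cl; have := @right_end_nat c s cl.
case: (c s) => [||k]; do 2 case: (_ c s) => //=; case: (s \in I) => //=;
  by do ?[move=> /(_ isT) | move=> ?].
Qed.

End ClanCounts.

(** * The antidiagonal form *)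

Section Form.
Variables (F : fieldType) (N : nat).
Implicit Types (x y z : 'cV[F]_N) (U W : {vspace 'cV[F]_N}).

Lemma tr_antidiag : (antidiag F N)^T = antidiag F N.
Proof.
apply/matrixP => i j; rewrite !mxE; congr (_%:R); congr nat_of_bool.
by rewrite -(inj_eq rev_ord_inj) rev_ordK eq_sym.
Qed.

Lemma antidiagE x i : (antidiag F N *m x) i 0 = x (rev_ord i) 0.
Proof.
rewrite mxE (bigD1 (rev_ord i)) //= !mxE eqxx mul1r big1 ?addr0 // => j ji.
by rewrite mxE (negPf ji) mul0r.
Qed.

Lemma antidiagK : antidiag F N *m antidiag F N = 1%:M.
Proof.
apply/matrixP => i j; rewrite -[_ j]/(_ _ j) !mxE (bigD1 (rev_ord i)) //= !mxE.
rewrite eqxx mul1r rev_ordK big1 ?addr0 1?eq_sym // => k ki.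
by rewrite mxE (negPf ki) mul0r.
Qed.

Definition jform x y : F := (x^T *m antidiag F N *m y) 0 0.

Lemma jformE x y : jform x y = \sum_i x i 0 * y (rev_ord i) 0.
Proof.
rewrite /jform -mulmxA mxE; apply: eq_bigr => i _.
by rewrite antidiagE mxE.
Qed.

Lemma jform_sym x y : jform x y = jform y x.
Proof.
rewrite !jformE (reindex_inj rev_ord_inj) /=; apply: eq_bigr => i _.
by rewrite rev_ordK mulrC.
Qed.

Lemma jformDr x y z : jform x (y + z) = jform x y + jform x z.
Proof. by rewrite /jform mulmxDr mxE. Qed.

Lemma jformZr a x y : jform x (a *: y) = a * jform x y.
Proof. by rewrite /jform -scalemxAr mxE. Qed.

Lemma jformBr x y z : jform x (y - z) = jform x y - jform x z.
Proof. by rewrite jformDr -scaleN1r jformZr mulN1r. Qed.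

Lemma jformBl x y z : jform (y - z) x = jform y x - jform z x.
Proof. by rewrite jform_sym jformBr !(jform_sym x). Qed.

Lemma jform0r x : jform x 0 = 0.
Proof. by rewrite -(scale0r 0) jformZr mul0r. Qed.

Lemma jform_sumr (I : finType) x (Y : I -> 'cV[F]_N) :
  jform x (\sum_i Y i) = \sum_i jform x (Y i).
Proof. exact: (big_morph (jform x) (jformDr x) (jform0r x)). Qed.

Lemma jform_delta i y : jform (delta_mx i 0) y = y (rev_ord i) 0.
Proof.
rewrite jformE (bigD1 i) //= mxE !eqxx mul1r big1 ?addr0 // => j ji.
by rewrite mxE (negPf ji) mul0r.
Qed.

Lemma jform_mul (g : 'M[F]_N) x y : g^T *m antidiag F N *m g = antidiag F N ->
  jform (g *m x) (g *m y) = jform x y.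
Proof. by move=> gO; rewrite /jform trmx_mul !mulmxA -[in RHS]gO !mulmxA. Qed.

Lemma jform_mulP (g : 'M[F]_N) :
  (forall i j, jform (col i g) (col j g) = (j == rev_ord i)%:R) ->
  g^T *m antidiag F N *m g = antidiag F N.
Proof.
move=> gO; apply/matrixP => i j; rewrite [RHS]mxE -gO /jform.
rewrite !mxE; apply: eq_bigr => k _; rewrite !mxE.
by congr (_ * _); apply: eq_bigr => l _; rewrite !mxE.
Qed.

(** Encoded as the kernel of a single matrix, a basis of [U] paired through the form, so that its
    dimension comes from rank-nullity. *)
Definition perp U : {vspace 'cV[F]_N} :=
  lker (linfun (mulmx ((\matrix_(k < \dim U) ((vbasis U)`_k)^T) *m antidiag F N))).

Lemma memv_perp U x : reflect (forall u, u \in U -> jform u x = 0) (x \in perp U).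
Proof.
have E (k : 'I_(\dim U)) :
    ((\matrix_(k < \dim U) ((vbasis U)`_k)^T) *m antidiag F N *m x) k 0 =
    jform (vbasis U)`_k x.
  transitivity (row k ((\matrix_(k < \dim U) ((vbasis U)`_k)^T)
      *m antidiag F N *m x) 0 0); first by rewrite [RHS]mxE.
  by rewrite !row_mul rowK.
rewrite memv_ker lfunE /=; apply: (iffP eqP) => [x0 u uU | x0].
  rewrite (coord_vbasis uU) jform_sym jform_sumr big1 // => k _.
  by rewrite jformZr jform_sym -E x0 mxE mulr0.
apply/colP => k; rewrite E x0 ?mxE //.
by rewrite vbasis_mem // mem_nth // size_tuple.
Qed.

(** The rows of the defining matrix are independent because the form is invertible; a right inverse
    makes the map onto, and rank-nullity applies. *)
Lemma dim_perp U : (\dim (perp U) + \dim U)%N = N.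
Proof.
set A := (\matrix_(k < \dim U) ((vbasis U)`_k)^T).
have fA : row_free (A *m antidiag F N).
  have uJ : antidiag F N \in unitmx by apply: (proj1 (mulmx1_unit antidiagK)).
  rewrite /row_free mxrankMfree ?row_free_unit //.
  apply: inj_row_free => v vA.
  apply/rowP => k; rewrite mxE.
  have := basis_free (vbasisP U) => /freeP; apply.
  rewrite -[RHS]trmx0 -vA mulmx_sum_row linear_sum /=; apply: eq_bigr => j _.
  by rewrite linearZ /= rowK trmxK.
have [B AB] := row_freeP fA.
have := limg_ker_dim (linfun (mulmx (A *m antidiag F N)) : 'Hom('cV[F]_N, 'cV[F]_(\dim U))) fullv.
rewrite capfv (_ : (_ @: fullv)%VS = fullv).
  rewrite !dimvf !dim_matrix => d.
  by rewrite -[RHS]muln1 -[X in (_ + X)%N = _]muln1; exact: d.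
apply/eqP; rewrite eqEsubv subvf; apply/subvP => w _.
rewrite -[w]mul1mx -AB -mulmxA.
have -> : A *m antidiag F N *m (B *m w) =
  (linfun (mulmx (A *m antidiag F N)) : 'Hom('cV[F]_N, 'cV[F]_(\dim U))) (B *m w).
  by rewrite lfunE.
exact: memv_img (memvf _).
Qed.

End Form.

(** * Coordinate subspaces, flags of matrices and the projection onto [En] *)

Section StandardSpans.
Variables (F : fieldType) (n : nat).
Implicit Types (x y v : 'cV[F]_(n + n)) (U W : {vspace 'cV[F]_(n + n)}).
Implicit Types (S : {set 'I_(n + n)}) (g h : 'M[F]_(n + n)).

Lemma memv_standard S v :
  reflect (forall k, k \notin S -> v k 0 = 0) (v \in standard_span F S).
Proof.
apply: (iffP idP) => [vS k kS | v0].
  have /subvP/(_ v vS) :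
      (standard_span F S <= lker (linfun (mulmx (delta_mx ord0 k : 'rV[F]_(n + n)))))%VS.
    apply/span_subvP => _ /mapP[i iS ->]; rewrite mem_enum in iS.
    rewrite memv_ker lfunE /= mul_delta_mx_cond.
    by rewrite (_ : (k == i) = false) ?mulr0n //; apply: contraNF kS => /eqP->.
  rewrite memv_ker lfunE /= -rowE => /eqP/rowP/(_ 0).
  by rewrite !mxE.
rewrite (matrix_sum_delta v); apply: memv_suml => i _; rewrite big_ord1.
case: (boolP (i \in S)) => iS; last by rewrite v0 // scale0r mem0v.
rewrite memvZ // memv_span //; exact: image_f.
Qed.

Lemma memv_standard_setC S v :
  reflect (forall k, k \in S -> v k 0 = 0) (v \in standard_span F (~: S)).
Proof.
apply: (iffP (memv_standard _ _)) => v0 k kS; apply: v0; by rewrite !inE ?negbK in kS *.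
Qed.

Definition coord_proj S : 'M[F]_(n + n) := diag_mx (\row_k (k \in S)%:R).

Lemma coord_projE S v k : (coord_proj S *m v) k 0 = if k \in S then v k 0 else 0.
Proof. by rewrite mul_diag_mx !mxE; case: (k \in S); rewrite ?mul1r ?mul0r. Qed.

(** The spans of [S] and of its complement have at most the expected dimensions and are
    complementary, so both bounds are attained. *)
Lemma dim_standard S : \dim (standard_span F S) = #|S|.
Proof.
have le S' : (\dim (standard_span F S') <= #|S'|)%N.
  by apply: leq_trans (dim_span _) _; rewrite size_map -cardE.
have full : (standard_span F S + standard_span F (~: S))%VS = fullv.
  apply/eqP; rewrite eqEsubv subvf; apply/subvP => v _.
  rewrite -(subrK (coord_proj S *m v) v) addrC memv_add //.
    by apply/memv_standard => k kS; rewrite coord_projE (negPf kS).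
  by apply/memv_standard_setC => k kS; rewrite [LHS]mxE [X in _ + X]mxE coord_projE kS subrr.
have := le S; have := le (~: S); have := cardsC S.
have := dimv_sum_cap (standard_span F S) (standard_span F (~: S)).
have := dimvf ('cV[F]_(n + n) : vectType F).
rewrite full dim_matrix card_ord => ->.
rewrite -[LHS](_ : n + n + \dim (standard_span F S :&: standard_span F (~: S)) = _)%N; last first.
  by rewrite -[X in (X + _)%N]muln1.
have -> : \dim (standard_span F S :&: standard_span F (~: S))%VS = 0%N.
  apply/eqP; rewrite dimv_eq0; apply/eqP/vspaceP => v; rewrite memv_cap memv0.
  apply/andP/eqP => [[/memv_standard v1 /memv_standard_setC v2] | ->]; last by rewrite !mem0v.
  by apply/colP => k; rewrite mxE; case: (boolP (k \in S)) => [/v2 | /v1].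
lia.
Qed.

Lemma memv_translate g U v : g \in unitmx ->
  (v \in translate g U) = (invmx g *m v \in U).
Proof.
move=> gU; apply/memv_imgP/idP => [[u uU ->] | vU].
  by rewrite lfunE /= mulKmx.
by exists (invmx g *m v); rewrite // lfunE /= mulKVmx.
Qed.

Lemma translateM g h U : translate (g *m h) U = translate g (translate h U).
Proof.
rewrite /translate -limg_comp; congr lfun_img; apply/lfunP => v.
by rewrite comp_lfunE !lfunE /= mulmxA.
Qed.

Lemma translate1 U : translate 1%:M U = U.
Proof. by apply/vspaceP => v; rewrite memv_translate ?unitmx1 // invmx1 mul1mx. Qed.

Lemma translateK g U : g \in unitmx -> translate (invmx g) (translate g U) = U.
Proof. by move=> gU; rewrite -translateM mulVmx // translate1. Qed.

Lemma lker_translate g : g \in unitmx ->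
  lker (linfun (mulmx g) : 'End('cV[F]_(n + n))) == 0%VS.
Proof.
move=> gU; apply/lker0P => x y; rewrite !lfunE /= => /(congr1 (mulmx (invmx g))).
by rewrite !mulKmx.
Qed.

Lemma dim_translate g U : g \in unitmx -> \dim (translate g U) = \dim U.
Proof. by move=> gU; rewrite limg_dim_eq // (eqP (lker_translate gU)) capv0. Qed.

Lemma translate_cap g U W : g \in unitmx ->
  translate g (U :&: W) = (translate g U :&: translate g W)%VS.
Proof. by move=> gU; apply/vspaceP => v; rewrite !(memv_cap, memv_translate). Qed.

Lemma translate_add g U W : translate g (U + W) = (translate g U + translate g W)%VS.
Proof. exact: limgD. Qed.

Definition initial i : {set 'I_(n + n)} := [set k : 'I_(n + n) | (k < i)%N].

Lemma flagE g i : flag g i = translate g (standard_span F (initial i)).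
Proof.
rewrite /translate limg_span /flag -map_comp.
rewrite (_ : enum (initial i) = [seq k : 'I_(n + n) <- enum 'I_(n + n) | (k < i)%N]).
  by congr span; apply: eq_map => k /=; rewrite lfunE /= -colE.
rewrite /enum_mem -filter_predI; apply: eq_filter => k /=.
by rewrite /= !inE andbT.
Qed.

Lemma flagM g h i : flag (g *m h) i = translate g (flag h i).
Proof. by rewrite !flagE translateM. Qed.

Lemma memv_flag g i v : g \in unitmx ->
  reflect (forall k : 'I_(n + n), (i <= k)%N -> (invmx g *m v) k 0 = 0)
          (v \in flag g i).
Proof.
move=> gU; rewrite flagE memv_translate //.
apply: (iffP (memv_standard _ _)) => v0 k ki; apply: v0.
  by rewrite inE -leqNgt.
by move: ki; rewrite inE -leqNgt.
Qed.

Lemma card_initial i : (i <= n + n)%N -> #|initial i| = i.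
Proof.
move=> iN; rewrite card_set_sum.
rewrite -(sum_ord_widen xpredT iN) /=.
by rewrite sum1_card card_ord.
Qed.

Lemma flag_sub g i j : (i <= j)%N -> (flag g i <= flag g j)%VS.
Proof.
move=> ij; rewrite !flagE; apply: limgS; apply/subvP => v /memv_standard v0.
apply/memv_standard => k; rewrite inE -leqNgt => jk; apply: v0.
by rewrite inE -leqNgt (leq_trans ij).
Qed.

Lemma dim_flag g i : g \in unitmx -> (i <= n + n)%N -> \dim (flag g i) = i.
Proof.
by move=> gU iN; rewrite flagE dim_translate // dim_standard card_initial.
Qed.

Lemma flag_full g : g \in unitmx -> flag g (n + n) = fullv.
Proof.
move=> gU; apply/vspaceP => v; rewrite memvf; apply/memv_flag => // k.
by rewrite leqNgt ltn_ord.
Qed.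

Lemma EntildeE : Entilde F n = standard_span F (~: initial n).
Proof. by congr standard_span; apply/setP => k; rewrite !inE -leqNgt. Qed.

Lemma dim_En : \dim (En F n) = n.
Proof. by rewrite dim_standard card_initial // leq_addr. Qed.

Lemma dim_Entilde : \dim (Entilde F n) = n.
Proof.
rewrite EntildeE dim_standard; have := cardsC (initial n).
rewrite card_initial ?leq_addr // card_ord; lia.
Qed.

Definition pr : 'End('cV[F]_(n + n)) := daddv_pi (En F n) (Entilde F n).

Lemma En_cap_Entilde : (En F n :&: Entilde F n = 0)%VS.
Proof.
rewrite EntildeE; apply/vspaceP => v; rewrite memv_cap memv0.
apply/andP/eqP => [[/memv_standard v1 /memv_standard_setC v2] | ->]; last by rewrite !mem0v.
by apply/colP => k; rewrite mxE; case: (boolP (k \in initial n)) => [/v2 | /v1].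
Qed.

Lemma En_add_Entilde : (En F n + Entilde F n = fullv)%VS.
Proof.
apply/eqP; rewrite eqEdim subvf dimvf dim_matrix /=.
have := dimv_sum_cap (En F n) (Entilde F n).
rewrite En_cap_Entilde dimv0 addn0 dim_En dim_Entilde => ->.
by apply: eq_leq; exact: muln1.
Qed.

Lemma pr_id v : v \in En F n -> pr v = v.
Proof. by move=> vE; rewrite /pr daddv_pi_id // En_cap_Entilde. Qed.

Lemma pr_mem v : pr v \in En F n.
Proof. exact: memv_pi. Qed.

Lemma pr_co_mem v : v - pr v \in Entilde F n.
Proof.
have E := @daddv_pi_add _ _ (En F n) (Entilde F n) v En_cap_Entilde.
rewrite -[X in X - _]E ?En_add_Entilde ?memvf //.
by rewrite addrAC subrr add0r memv_pi.
Qed.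

Lemma pr_idem v : pr (pr v) = pr v.
Proof. by rewrite pr_id ?pr_mem. Qed.

Lemma memv_En v : (v \in En F n) = (pr v == v).
Proof. by apply/idP/eqP => [/pr_id // | <-]; exact: pr_mem. Qed.

Lemma memv_Entilde v : (v \in Entilde F n) = (pr v == 0).
Proof.
apply/idP/eqP => [vT | v0]; last by have := pr_co_mem v; rewrite v0 subr0.
apply/eqP; rewrite -memv0 -En_cap_Entilde memv_cap pr_mem /=.
by rewrite -[pr v](subKr v) memvB // pr_co_mem.
Qed.

Lemma jform_En x y : x \in En F n -> y \in En F n -> jform x y = 0.
Proof.
move=> /memv_standard x0 /memv_standard y0; rewrite jformE big1 // => i _.
have := x0 i; have := y0 (rev_ord i); rewrite !inE -!leqNgt /=.
case: (leqP n i) => [_ _ -> // | ni]; first by rewrite mul0r.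
by move=> -> //; rewrite ?mulr0 //; lia.
Qed.

Lemma jform_Entilde x y : x \in Entilde F n -> y \in Entilde F n -> jform x y = 0.
Proof.
rewrite EntildeE => /memv_standard_setC x0 /memv_standard_setC y0.
rewrite jformE big1 // => i _.
have := x0 i; have := y0 (rev_ord i); rewrite !inE /=.
case: (ltnP i n) => [_ _ -> // | ni]; first by rewrite mul0r.
by have iN := ltn_ord i; move=> -> //; rewrite ?mulr0 //; lia.
Qed.

(** Both sides equal [jform (pr x) (y - pr y)], because [En] and [Entilde] are isotropic. *)
Lemma jform_pr x y : jform (pr x) y = jform x (y - pr y).
Proof.
have -> : jform (pr x) y = jform (pr x) (y - pr y).
  by rewrite jformBr (jform_En (pr_mem x) (pr_mem y)) subr0.
rewrite -[in LHS](subKr x (pr x)) jformBl.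
by rewrite (jform_Entilde (pr_co_mem x) (pr_co_mem y)) subr0.
Qed.

End StandardSpans.

(** * Clans of isotropic flags *)

Section IsotropicFlag.
Variables (F : fieldType) (n : nat) (g : 'M[F]_(n + n)).
Hypothesis gO : g^T *m antidiag F (n + n) *m g = antidiag F (n + n).
Implicit Types (s t : 'I_(n + n)) (U W : {vspace 'cV[F]_(n + n)}).

Local Notation V := (flag g).
Local Notation E := (En F n).
Local Notation T := (Entilde F n).
Local Notation p := (pr F n).

Lemma orthogonal_unitmx : g \in unitmx.
Proof.
apply: (proj2 (@mulmx1_unit _ _ (antidiag F _ *m g^T *m antidiag F _) g _)).
by rewrite -!mulmxA (mulmxA g^T) gO antidiagK.
Qed.

Let V_sub := @flag_sub F n g.
Let dimV i := @dim_flag F n g i orthogonal_unitmx.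
Let V_full : V (n + n) = fullv := flag_full orthogonal_unitmx.
Let p_idem := @pr_idem F n.
Let memE := @memv_En F n.
Let memT := @memv_Entilde F n.

Lemma perp_add U W : perp (U + W)%VS = (perp U :&: perp W)%VS.
Proof.
apply/vspaceP => x; rewrite memv_cap; apply/memv_perp/andP.
  move=> xUW; split; apply/memv_perp => u uU; apply: xUW.
    by rewrite (subvP (addvSl _ _)).
  by rewrite (subvP (addvSr _ _)).
move=> [/memv_perp xU /memv_perp xW] _ /memv_addP[u uU [w wW ->]].
by rewrite jform_sym jformDr !(jform_sym x) xU // xW // addr0.
Qed.

Lemma perp_eq U W : (\dim U + \dim W)%N = (n + n)%N ->
  (forall u w, u \in U -> w \in W -> jform u w = 0) -> W = perp U.
Proof.
move=> d UW; apply/eqP; rewrite eqEdim; apply/andP; split.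
  by apply/subvP => w wW; apply/memv_perp => u uU; apply: UW.
by have := dim_perp U; lia.
Qed.

Lemma perp_En : E = perp E.
Proof. by apply: perp_eq => [|u w]; [rewrite dim_En | exact: jform_En]. Qed.

Lemma perp_Entilde : T = perp T.
Proof. by apply: perp_eq => [|u w]; [rewrite dim_Entilde | exact: jform_Entilde]. Qed.

Lemma jform_flag i u v : u \in V (n + n - i)%N -> v \in V i -> jform u v = 0.
Proof.
have gU := orthogonal_unitmx.
move=> /(memv_flag _ _ gU) u0 /(memv_flag _ _ gU) v0.
rewrite -(mulKVmx gU u) -(mulKVmx gU v) jform_mul // jformE big1 // => k _.
case: (leqP (n + n - i) k) => ki; first by rewrite u0 ?mul0r.
by rewrite v0 ?mulr0 //=; have := ltn_ord k; lia.
Qed.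

Lemma flag_perp i : (i <= n + n)%N -> V i = perp (V (n + n - i)%N).
Proof.
move=> iN; apply: perp_eq => [|u w]; last exact: jform_flag.
by rewrite !dimV ?leq_subr // subnK.
Qed.

(** As [U] is its own orthogonal, [V i :&: U] is the orthogonal of the sum of [U] and the flag space
    of index 2n - i. *)
Lemma dim_flag_cap_dual U i : U = perp U -> \dim U = n -> (i <= n + n)%N ->
  (\dim (V i :&: U) + n)%N = (i + \dim (V (n + n - i) :&: U))%N.
Proof.
move=> UU dU iN; rewrite [in LHS]UU (flag_perp iN) -perp_add.
have := dim_perp (V (n + n - i) + U); have := dimv_sum_cap (V (n + n - i)) U.
rewrite dU (dimV (leq_subr _ _)); lia.
Qed.

Lemma jump_dual U s : U = perp U -> \dim U = n ->
  jump V U (rev_ord s) = ~~ jump V U s.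
Proof.
move=> UU dU; have sN := ltn_ord s.
have := jump_dim V_sub dimV U sN.
have := jump_dim V_sub dimV U (ltn_ord (rev_ord s)).
have := dim_flag_cap_dual UU dU sN.
have := dim_flag_cap_dual UU dU (ltnW sN).
rewrite /= subnSK //.
by case: jump; case: jump => //=; lia.
Qed.

Let d i j := \dim (V i :&: p @^-1: V j).

(** By adjointness, V_i ∩ p^-1 V_j is the orthogonal of (1 - p) V_(2n-j) + V_(2n-i), whose dimension
    [dim_img_add] computes. As i <= j, V_(2n-j) lies in V_(2n-i), and on it the preimages of
    V_(2n-i) under 1 - p and p agree. *)
Lemma dim_pull_dual i j : (i <= j)%N -> (j <= n + n)%N ->
  (d i j + (n + n) = i + j + d (n + n - j) (n + n - i))%N.
Proof.
move=> ij jN; have iN := leq_trans ij jN.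
have qE v : (\1 - p)%VF v = v - p v.
  by rewrite add_lfunE opp_lfunE id_lfunE.
have e1 : (V i :&: p @^-1: V j)%VS =
    perp ((\1 - p)%VF @: V (n + n - j) + V (n + n - i)).
  rewrite addvC perp_add -flag_perp //; apply/vspaceP => x; rewrite !memv_cap.
  congr andb; rewrite -memv_preim (flag_perp jN).
  apply/memv_perp/memv_perp => H u.
    by move=> /memv_imgP[w wV ->]; rewrite qE jform_sym -jform_pr jform_sym H.
  by move=> uV; rewrite jform_sym jform_pr jform_sym H // -qE memv_img.
have e2 : (V (n + n - j) :&: (\1 - p)%VF @^-1: V (n + n - i))%VS =
          (V (n + n - j) :&: p @^-1: V (n + n - i))%VS.
  apply/vspaceP => x; rewrite !memv_cap -!memv_preim qE.
  case: (boolP (x \in V (n + n - j)%N)) => //= xV.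
  have xV' : x \in V (n + n - i)%N by apply: (subvP (V_sub _)) xV; lia.
  by apply/idP/idP => h; [rewrite -[p x](subKr x) memvB | rewrite memvB].
have := dim_perp ((\1 - p)%VF @: V (n + n - j) + V (n + n - i)).
have := dim_img_add dimV (\1 - p)%VF (leq_subr j (n + n)) (leq_subr i (n + n)).
rewrite -e1 e2 /d.
move: (\dim (_ + _))%VS (\dim (V (n + n - j) :&: _))%VS (\dim (V i :&: _))%VS. lia.
Qed.

(** A pair is a mixed second difference 1 of [d], whose differences in the first argument are 0 or
    1. [dim_pull_dual] permutes the four corners up to the term i + j, which has no mixed
    difference. *)
Lemma flag_matching_dual s t : flag_matching V p s t ->
  flag_matching V p (rev_ord t) (rev_ord s).
Proof.
case/and3P => st; rewrite /jump -!/(d _ _) => j1 j2.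
have tN := ltn_ord t; have sN := ltn_ord s.
have J k j : (k < n + n)%N -> d k.+1 j = d k j \/ d k.+1 j = (d k j).+1.
  move=> kN; rewrite /d (jump_dim V_sub dimV) //; case: jump => /=; rewrite ?addn0 ?addn1; auto.
rewrite /flag_matching /jump -!/(d _ _) /= !subnSK //.
have := @dim_pull_dual s t; have := @dim_pull_dual s t.+1.
have := @dim_pull_dual s.+1 t; have := @dim_pull_dual s.+1 t.+1.
have := J (n + n - t.+1)%N (n + n - s)%N; have := J (n + n - t.+1)%N (n + n - s.+1)%N.
have := J s t; have := J s t.+1.
rewrite !subnSK //; lia.
Qed.

(* For s < n the step V_(s+1) is isotropic, so <p v, v> = <v, v> / 2 = 0 there; but matching s with
   rev s would make p v a vector of V_s^perp outside V_(s+1)^perp, that is <p v, v> <> 0. *)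
Lemma flag_matching_rev s : 2%:R != 0 :> F -> ~ flag_matching V p s (rev_ord s).
Proof.
move=> two M; have [v [v1 v2 v3 v4]] := matching_witness V_sub M.
have sN := ltn_ord s.
have lt : (s < rev_ord s)%N by case/and3P: M.
have e1 : (n + n - (rev_ord s).+1)%N = s by move=> /=; lia.
have e2 : (n + n - rev_ord s)%N = s.+1 by move=> /=; lia.
have sym x : x \in V s.+1 -> jform (p x) x = 0.
  move=> xV; apply/eqP; rewrite -(mulIr_eq0 _ (mulIf two)) mulr_natr mulr2n.
  rewrite {1}jform_pr jformBr [X in _ - X]jform_sym subrK.
  rewrite (@jform_flag s.+1) //; apply: (subvP (V_sub _)) xV => //=; move: lt => /=; lia.
case/negP: v4; rewrite flag_perp ?(ltnW (ltn_ord _)) //; apply/memv_perp => u.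
rewrite e2 => uV; have [a aV] := flag_scale V_sub dimV sN v1 v2 uV.
rewrite -(subrK (a *: v) u) jform_sym jformDr jformZr sym // mulr0 addr0 jform_sym.
by apply: (@jform_flag (rev_ord s).+1); rewrite ?e1.
Qed.

Lemma is_DIII_clan_of_flag : 2%:R != 0 :> F ->
  ~~ odd (\dim (V n :&: T)) -> is_DIII (clan_of_flag V n p E T).
Proof.
move=> two even; set c := clan_of_flag V n p E T.
have mat := matching_clan_of_flag V_sub dimV p_idem memE memT.
have nat_cl := clan_of_flag_nat (n := n) V p E T.
have jE s : jump V E (rev_ord s) = ~~ jump V E s := jump_dual s perp_En (dim_En F n).
have jT s : jump V T (rev_ord s) = ~~ jump V T s := jump_dual s perp_Entilde (dim_Entilde F n).
have cl : is_clan c.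
  by apply: is_clan_clan_of_flag; rewrite ?dim_En ?dim_Entilde.
have opp_plus x : (opp_symbol x == SPlus) = (x == SMinus) by case: x.
have opp_minus x : (opp_symbol x == SMinus) = (x == SPlus) by case: x.
have opp_nat x : is_nat_symbol (opp_symbol x) = is_nat_symbol x by case: x.
have opp_eq x y : is_nat_symbol x -> (opp_symbol y == opp_symbol x) = (y == x).
  by case: x; case: y.
have revE (e : {ffun 'I_(n + n) -> symbol}) s :
    clan_rev (clan_opp e) s = opp_symbol (e (rev_ord s)) by rewrite !ffunE.
split=> //.
- split=> [s|s|s t].
  + by rewrite revE opp_plus /c clan_of_flag_plus clan_of_flag_minus jE jT negbK.
  + by rewrite revE opp_minus /c clan_of_flag_plus clan_of_flag_minus jE jT negbK.
  have -> : matching (clan_rev (clan_opp c)) s t = matching c (rev_ord t) (rev_ord s).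
    rewrite /matching !revE opp_nat.
    have -> : (rev_ord t < rev_ord s)%N = (s < t)%N.
      by have := ltn_ord s; have := ltn_ord t; rewrite /=; lia.
    case: (boolP (is_nat_symbol (c (rev_ord s)))) => h.
      rewrite opp_eq //; case: eqP => [e|e]; first by rewrite e h eqxx.
      by case: eqP => [/esym // | _]; rewrite /= andbF.
    rewrite /=; case: eqP => e; last by rewrite andbF.
    by rewrite -e (negPf h).
  rewrite /c !mat; apply/idP/idP => [|M]; first exact: flag_matching_dual.
  by rewrite -[s]rev_ordK -[t]rev_ordK flag_matching_dual.
- move=> s ns cs.
  (* Condition (ii) does not change when [s] is replaced by [rev_ord s], so the lower of the two
     positions can be taken as the left end. *)
  have half (r : 'I_(n + n)) : is_nat_symbol (c r) -> c (rev_ord r) = c r ->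
      (r < rev_ord r)%N -> False.
    move=> nr e lt; apply: (@flag_matching_rev r two).
    by rewrite -mat /matching -/c nr e eqxx.
  case: (ltngtP s (rev_ord s)) => lt.
  + by apply: (half s).
  + by apply: (half (rev_ord s)); rewrite ?rev_ordK // -cs.
  + by move: lt => /=; have := ltn_ord s; lia.
(* The number in condition (iii) is the second family at [i = n], that is, dim (V_n ∩ Ẽ_n). *)
rewrite -[(_ + _)%N]/(nb_minus c n + nb_completed c n)%N.
by rewrite nb_minus_clan_of_flag // leq_addr.
Qed.

End IsotropicFlag.

(** * Parity of dim (V_n ∩ Ẽ_n) *)

Section Parity.
Variables (F : fieldType) (n : nat).
Implicit Types (g : 'M[F]_(n + n)).

Lemma det_antidiag_sqr m : \det (antidiag F m) * \det (antidiag F m) = 1.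
Proof. by rewrite -det_mulmx antidiagK det1. Qed.

Lemma conj_antidiagE m (A : 'M[F]_m) i j :
  (antidiag F m *m A^T *m antidiag F m) i j = A (rev_ord j) (rev_ord i).
Proof.
rewrite mxE (bigD1 (rev_ord j)) //= [antidiag _ _ _ _]mxE rev_ordK eqxx mulr1.
rewrite big1 ?addr0 => [|k kj]; last first.
  rewrite [antidiag _ _ _ _]mxE.
  by rewrite -(inj_eq rev_ord_inj) rev_ordK eq_sym (negPf kj) mulr0.
rewrite mxE (bigD1 (rev_ord i)) //= !mxE eqxx mul1r big1 ?addr0 // => k ki.
by rewrite mxE (negPf ki) mul0r.
Qed.

(* Multiplying g by the right half of its inverse, completed by an identity block,
   gives \det g * \det A = \det A. *)
Lemma det_orthogonal_ulsubmx g :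
  g^T *m antidiag F _ *m g = antidiag F _ -> ulsubmx g \in unitmx -> \det g = 1.
Proof.
move=> gO; set A := ulsubmx g; rewrite unitmxE unitfE => A0.
pose h := antidiag F _ *m g^T *m antidiag F _.
have gh : g *m h = 1%:M.
  by apply: mulmx1C; rewrite /h -!mulmxA (mulmxA g^T) gO antidiagK.
have hD : drsubmx h = antidiag F n *m A^T *m antidiag F n.
  apply/matrixP => i j; rewrite conj_antidiagE [LHS]mxE [LHS]mxE conj_antidiagE [RHS]mxE [RHS]mxE.
  by congr (g _ _); apply: val_inj => /=; have := ltn_ord i; have := ltn_ord j; lia.
have : \det (g *m block_mx 1%:M (ursubmx h) 0 (drsubmx h)) = \det A.
  have : g *m h = block_mx 1%:M 0 0 1%:M by rewrite gh -scalar_mx_block.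
  rewrite -{1}[g]submxK -{1}[h]submxK mulmx_block => /eq_block_mx[_ e1 _ e2].
  rewrite -{1}[g]submxK mulmx_block e1 e2 !mulmx1 !mulmx0 !addr0.
  by rewrite det_lblock det1 mulr1.
rewrite det_mulmx det_ublock det1 mul1r hD !det_mulmx det_tr.
rewrite mulrAC det_antidiag_sqr mul1r => e.
by apply: (mulIf A0); rewrite e mul1r.
Qed.

(** The product of the transpositions of [x] and [rev_ord x] for [x] in [L]. They are disjoint,
    since [L] has no repetition and [rev_ord] sends the lower half to the upper one, so the sign
    counts them. *)
Lemma swap_perm (L : seq 'I_(n + n)) : uniq L -> all (fun k : 'I_(n + n) => k < n)%N L ->
  exists2 s : {perm 'I_(n + n)}, odd_perm s = odd (size L) &
    forall k, s k = if (k \in L) || (rev_ord k \in L) then rev_ord k else k.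
Proof.
elim: L => [_ _ | x L IH /= /andP[xL uL] /andP[xn Ln]].
  by exists 1%g => [|k]; rewrite ?odd_perm1 ?perm1.
have [s sodd sE] := IH uL Ln.
have xrx : rev_ord x != x by rewrite -(inj_eq val_inj) /=; have := ltn_ord x; lia.
have rxL : rev_ord x \notin L.
  by apply/negP => /(allP Ln) /=; have := ltn_ord x; lia.
exists (tperm x (rev_ord x) * s)%g => [|k].
  by rewrite odd_permM odd_tperm eq_sym xrx sodd.
rewrite permM !inE; case: tpermP => [->|->|/eqP kx /eqP krx].
- by rewrite sE rev_ordK (negPf rxL) (negPf xL) eqxx.
- by rewrite sE (negPf xL) (negPf rxL) rev_ordK eqxx orbT.
rewrite sE (negPf kx) /= -(inj_eq rev_ord_inj) rev_ordK.
by rewrite (negPf krx) /=.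
Qed.

(* Swapping columns s and rev s for each s < n at which the kernel Entilde jumps makes the
   upper left block invertible, so the swap has determinant 1. *)
Lemma even_cap_Entilde g : 2%:R != 0 :> F -> \det g = 1 ->
  g^T *m antidiag F _ *m g = antidiag F _ ->
  ~~ odd (\dim (flag g n :&: Entilde F n)).
Proof.
move=> two g1 gO; have gU := orthogonal_unitmx gO.
have V_sub := @flag_sub F n g.
have dimV i := @dim_flag F n g i gU.
pose S := [set s : 'I_(n + n) | jump (flag g) (Entilde F n) s && (s < n)%N].
have -> : \dim (flag g n :&: Entilde F n) = #|S|.
  rewrite (dim_jumps V_sub dimV) ?leq_addr //.
  by rewrite (sum_ord_widen _ (leq_addr n n)) card_set_sum.
have [s sodd sE] : exists2 s : {perm 'I_(n + n)}, odd_perm s = odd #|S| &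
    forall k, s k = if (k \in S) || (rev_ord k \in S) then rev_ord k else k.
  have [|s sodd sE] := @swap_perm (enum S) (enum_uniq _).
    by apply/allP => k; rewrite mem_enum inE => /andP[].
  by exists s => [|k]; rewrite ?sodd ?sE ?mem_enum -?cardE.
(* Commuting with [rev_ord] is what makes the column permutation preserve the form. *)
have srev k : s (rev_ord k) = rev_ord (s k).
  by rewrite !sE rev_ordK orbC; case: ifP; rewrite ?rev_ordK.
pose g' := col_perm s g.
have colg' j : col j g' = col (s j) g by apply/colP => i; rewrite !mxE.
have colgO i j : jform (col i g) (col j g) = (j == rev_ord i)%:R.
  by rewrite !colE jform_mul // jform_delta mxE eqxx andbT eq_sym.
have g'O : g'^T *m antidiag F _ *m g' = antidiag F _.
  apply: jform_mulP => i j; rewrite !colg' colgO -srev.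
  by rewrite (inj_eq perm_inj).
have : \det g' = 1.
  apply: det_orthogonal_ulsubmx => //.
  rewrite -row_free_unit; apply: inj_row_free => y yA.
  (* A row [y] killed by the upper left block becomes a vector of [Entilde] orthogonal to the first
     n columns of [g']; the aim is [eta = 0]. *)
  pose eta := antidiag F (n + n) *m col_mx y^T 0.
  have etaE j : jform eta (col j g) = (row_mx y 0 *m g) 0 j.
    rewrite /jform /eta trmx_mul tr_antidiag tr_col_mx trmxK trmx0.
    rewrite -(mulmxA _ (antidiag F _) (antidiag F _)) antidiagK mulmx1 colE mulmxA.
    by rewrite -colE mxE.
  have eta_g' (j : 'I_(n + n)) : (j < n)%N -> jform eta (col (s j) g) = 0.
    move=> jn; rewrite -colg'.
    have -> : j = lshift n (Ordinal jn) by apply: val_inj.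
    rewrite colg' etaE.
    have /rowP/(_ (Ordinal jn)) := yA; rewrite [RHS]mxE => <-.
    rewrite !mxE big_split_ord /= [X in _ + X]big1 ?addr0 => [|k _].
      by apply: eq_bigr => k _; rewrite row_mxEl !mxE.
    by rewrite row_mxEr mxE mul0r.
  have etaT : eta \in Entilde F n.
    rewrite EntildeE; apply/memv_standard_setC => k; rewrite inE => kn.
    rewrite antidiagE mxE; case: splitP => [j /= e|j _]; last by rewrite mxE.
    by have := ltn_ord j; lia.
  (* At each step below n some new vector is orthogonal to [eta]: a vector of [Entilde] if the step
     is in [S], otherwise the column of [g], which the swap leaves in place. *)
  have eta_flag k : (k <= n)%N -> (flag g k <= perp <[eta]>)%VS.
    elim: k => [_|k IH kn].
      rewrite (_ : flag g 0 = 0%VS) ?sub0v //.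
      by apply/eqP; rewrite -dimv_eq0 dimV.
    have kN : (k < n + n)%N by rewrite (leq_trans kn) // leq_addr.
    have IHk := subvP (IH (ltnW kn)).
    have mk v : jform eta v = 0 -> v \in perp <[eta]>.
      move=> v0; apply/memv_perp => _ /vlineP[a ->].
      by rewrite jform_sym jformZr jform_sym v0 mulr0.
    have [v [v1 v2 v3]] : exists v, [/\ v \in flag g k.+1, v \in perp <[eta]> & v \notin flag g k].
      case: (boolP (Ordinal kN \in S)) => kS.
        move: kS; rewrite inE => /andP[/(jumpP V_sub)[v [v1 v2 v3]] _].
        by exists v; split=> //; apply: mk; apply: jform_Entilde.
      exists (col (Ordinal kN) g); split.
      - apply/memv_flag => // j kj; rewrite colE mulKmx // mxE.
        by rewrite -(inj_eq val_inj) /= gtn_eqF.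
      - apply: mk; have := eta_g' (Ordinal kN) kn; rewrite sE (negPf kS) /=.
        rewrite (_ : (rev_ord _ \in S) = false) //.
        by rewrite inE; apply/negbTE/nandP; right => /=; lia.
      apply/negP => /(memv_flag _ _ gU)/(_ (Ordinal kN) (leqnn _))/eqP.
      by rewrite colE mulKmx // mxE !eqxx oner_eq0.
    apply/subvP => w wV; have [a aV] := flag_scale V_sub dimV kN v1 v3 wV.
    by rewrite -(subrK (a *: v) w) memvD ?memvZ // IHk.
  have etaV : eta \in flag g n.
    rewrite (flag_perp gO) ?leq_addr // addnK; apply/memv_perp => u uV.
    rewrite jform_sym; have /memv_perp := subvP (eta_flag n (leqnn n)) _ uV.
    by apply; rewrite memv_line.
  have : exists k, eta \in flag g k by exists n.
  (* Suppose [eta] is new at step [k]. Being in [Entilde], it puts [k] in [S], so the swap makes it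
     orthogonal to column [rev_ord k] of [g]. It is also orthogonal to the flag space of index
     [rev_ord k], hence to the next one, whose orthogonal is [flag g k]: a contradiction. *)
  move=> ex; case: (ex_minnP ex) => -[|k] ek kmin.
    have : eta = 0.
      by apply/eqP; rewrite -memv0; move: ek; rewrite (_ : flag g 0 = 0%VS) //;
         apply/eqP; rewrite -dimv_eq0 dimV.
    move=> /(congr1 (mulmx (antidiag F _))); rewrite mulmxA antidiagK mul1mx mulmx0.
    rewrite -[RHS]col_mx0 => /eq_col_mx[y0 _].
    by rewrite -[y]trmxK y0 trmx0.
  have kn : (k < n)%N by apply: kmin.
  have kN : (k < n + n)%N by rewrite (leq_trans kn) // leq_addr.
  have nek : eta \notin flag g k by apply/negP => /kmin; rewrite ltnn.
  have kS : Ordinal kN \in S.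
    by rewrite inE /= kn andbT; apply/(jumpP V_sub); exists eta.
  case/negP: nek; rewrite (flag_perp gO) ?(ltnW kN) //; apply/memv_perp => u uV.
  pose r := rev_ord (Ordinal kN).
  have rk : (n + n - k)%N = r.+1 by rewrite /=; lia.
  rewrite rk in uV.
  have c1 : col r g \in flag g r.+1.
    apply/memv_flag => // j kj; rewrite colE mulKmx // mxE.
    by rewrite -(inj_eq val_inj) gtn_eqF.
  have c2 : col r g \notin flag g r.
    apply/negP => /(memv_flag _ _ gU)/(_ r (leqnn _))/eqP.
    by rewrite colE mulKmx // mxE !eqxx oner_eq0.
  have [a aV] := flag_scale V_sub dimV (ltn_ord r) c1 c2 uV.
  rewrite -(subrK (a *: col r g) u) jform_sym jformDr jformZr.
  have := eta_g' (Ordinal kN) kn; rewrite sE kS => ->; rewrite mulr0 addr0.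
  by rewrite jform_sym (@jform_flag _ _ _ gO k.+1).
(* Both determinants are 1, so the sign is 1; an odd swap would give 1 = -1. *)
rewrite /g' col_permE det_mulmx g1 mul1r det_perm odd_permV sodd.
case: odd => //= /eqP; rewrite expr1 -subr_eq0 -opprD oppr_eq0.
by rewrite -mulr2n (negPf two).
Qed.

End Parity.

(** * Schubert cells *)

Section Schubert.
Variables (F : fieldType) (n : nat).
Implicit Types (g h b : 'M[F]_(n + n)) (U W : {vspace 'cV[F]_(n + n)}).
Implicit Types (s : 'I_(n + n)) (I : {set 'I_(n + n)}).

Lemma jump_flagM g h U i : g \in unitmx ->
  jump (flag (g *m h)) (translate g U) i = jump (flag h) U i.
Proof. by move=> gU; rewrite /jump !flagM -!translate_cap // !dim_translate. Qed.

Lemma SO_unitmx g : SO F n g -> g \in unitmx.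
Proof. by move=> [_ /orthogonal_unitmx]. Qed.

Lemma jump_flag_invmx g i : SO F n g ->
  jump (flag (invmx g)) (En F n) i = jump (flag 1%:M) (translate g (En F n)) i.
Proof.
move=> /SO_unitmx gU; rewrite -[invmx g]mulmx1 -[En F n in LHS](translateK _ gU).
by rewrite jump_flagM // unitmx_inv.
Qed.

Lemma flagM_Borel g b i : Borel F n b -> flag (g *m b) i = flag g i.
Proof.
move=> [/SO_unitmx bU b0]; rewrite flagM [RHS]flagE; congr translate.
apply/eqP; rewrite flagE eqEdim dim_translate // leqnn andbT.
apply/subvP => v /memv_imgP[u /memv_standard u0 ->].
rewrite lfunE; apply/memv_standard => k; rewrite inE -leqNgt => ik.
rewrite mxE big1 // => j _; case: (ltnP j k) => jk; first by rewrite b0 ?mul0r.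
by rewrite u0 ?mulr0 // inE -leqNgt (leq_trans ik).
Qed.

Let flag1_sub := @flag_sub F n 1%:M.
Let dim_flag1 i := @dim_flag F n 1%:M i (unitmx1 _ _).

Lemma memv_flag1 i (v : 'cV[F]_(n + n)) :
  reflect (forall k : 'I_(n + n), (i <= k)%N -> v k 0 = 0) (v \in flag 1%:M i).
Proof.
apply: (iffP (memv_flag _ _ (unitmx1 _ _))) => v0 k /v0; by rewrite invmx1 mul1mx.
Qed.

Lemma jump_flag1P U s :
  reflect (exists v, [/\ v \in flag 1%:M s.+1, v \in U & v s 0 != 0])
          (jump (flag 1%:M) U s).
Proof.
apply: (iffP (jumpP flag1_sub _ _)) => -[v [v1 v2 v3]]; exists v; split=> //.
  apply: contra v3 => /eqP vs; apply/memv_flag1 => k; rewrite leq_eqVlt.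
  case/orP => [/eqP/val_inj<- // | sk]; by move/memv_flag1: v1; apply.
by apply: contra v3 => /memv_flag1 ->.
Qed.

Lemma jump_standard I s : jump (flag 1%:M) (standard_span F I) s = (s \in I).
Proof.
apply/jump_flag1P/idP => [[v [_ /memv_standard v0 vs]] | sI].
  by apply: contraR vs => sI; rewrite v0.
exists (delta_mx s 0); split; last by rewrite mxE !eqxx oner_eq0.
  by apply/memv_flag1 => k sk; rewrite mxE -(inj_eq val_inj) /= gtn_eqF.
by apply/memv_standard => k kI; rewrite mxE; case: eqP kI => // ->; rewrite sI.
Qed.

Lemma jump_schubert g b I s : SO F n g -> Borel F n b ->
  translate g (En F n) = translate b (standard_span F I) ->
  jump (flag (invmx g)) (En F n) s = (s \in I).
Proof.
move=> gSO bB gE; rewrite jump_flag_invmx // gE -(jump_standard I s).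
have bU : b \in unitmx by case: bB => /SO_unitmx.
have fb i : flag b i = flag 1%:M i by rewrite -[b in LHS]mul1mx flagM_Borel.
by rewrite -[RHS](jump_flagM _ _ _ bU) /jump mulmx1 !fb.
Qed.

(** The reversal of [I] avoids [I] and has n elements, so it is the whole complement. *)
Lemma schubert_rev I s : schubert_index I -> (rev_ord s \in I) = (s \notin I).
Proof.
move=> [cI Irev _].
have sub : [set rev_ord i | i in I] \subset ~: I.
  by apply/subsetP => _ /imsetP[i iI ->]; rewrite inE Irev.
have /eqP e : [set rev_ord i | i in I] == ~: I.
  rewrite eqEcard sub card_imset; last exact: rev_ord_inj.
  by have := cardsC I; rewrite card_ord cI => /addnI ->; rewrite leqnn.

rewrite -in_setC -e; apply/idP/imsetP => [sI | [i iI ->]]; last by rewrite rev_ordK.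
by exists (rev_ord s); rewrite ?rev_ordK.
Qed.

(* The I-coordinates are injective on W since a vector of W leads at a position of I. *)
Lemma schubert_basis W I s : (forall t : 'I_(n + n), jump (flag 1%:M) W t = (t \in I)) -> s \in I ->
  exists w, [/\ w \in W, w \in flag 1%:M s.+1 &
                forall k, k \in I -> w k 0 = (k == s)%:R].
Proof.
move=> WI sI.
have inj : (W :&: flag 1%:M s.+1 :&: lker (linfun (mulmx (coord_proj F I))) = 0)%VS.
  apply/vspaceP => v; rewrite memv0 !memv_cap memv_ker lfunE /=.
  apply/andP/eqP => [[/andP[vW vs] /eqP vI] | ->]; last by rewrite !mem0v mulmx0 eqxx.
  have vI0 k : k \in I -> v k 0 = 0.
    by move=> kI; have := coord_projE I v k; rewrite vI kI mxE.
  have ex : exists i, v \in flag 1%:M i by exists s.+1.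
  case: (ex_minnP ex) => -[|i] vi imin.
    by apply/colP => k; rewrite mxE; move/memv_flag1: vi => ->.
  have iN : (i < n + n)%N by apply: leq_trans (imin _ vs) _.
  have ni : v (Ordinal iN) 0 != 0.
    apply/negP => /eqP v0; have : (i < i)%N; last by rewrite ltnn.
    apply: imin; apply/memv_flag1 => k; rewrite leq_eqVlt.
    case/orP => [/eqP e | ik]; last by move/memv_flag1: vi; apply.
    by rewrite -[k](_ : Ordinal iN = k) //; apply: val_inj.
  have : Ordinal iN \in I by rewrite -WI; apply/jump_flag1P; exists v.
  by move=> /vI0 v0; rewrite v0 eqxx in ni.
(* The inclusion is an equality because [W] and [standard_span F I] jump at the same steps and hence
   meet [flag 1%:M s.+1] in equal dimensions. *)
have img : (linfun (mulmx (coord_proj F I)) @: (W :&: flag 1%:M s.+1) =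
            flag 1%:M s.+1 :&: standard_span F I)%VS.
  apply/eqP; rewrite eqEdim; apply/andP; split.
    apply/subvP => _ /memv_imgP[v vWs ->]; rewrite lfunE /=.
    move: vWs; rewrite !memv_cap => /andP[_ /memv_flag1 vs].
    apply/andP; split.
      by apply/memv_flag1 => k sk; rewrite coord_projE vs // if_same.
    by apply/memv_standard => k kI; rewrite coord_projE (negPf kI).
  rewrite limg_dim_eq // [(W :&: _)%VS]capvC.
  rewrite !(dim_jumps flag1_sub dim_flag1) //.
  rewrite !(sum_ord_widen (N := n + n)) //; apply: eq_leq; apply: eq_bigr => k _.
  by rewrite WI jump_standard.
have : delta_mx s 0 \in (linfun (mulmx (coord_proj F I)) @: (W :&: flag 1%:M s.+1))%VS.
  rewrite img memv_cap; apply/andP; split.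
    by apply/memv_flag1 => k sk; rewrite mxE -(inj_eq val_inj) /= gtn_eqF.
  by apply/memv_standard => k kI; rewrite mxE; case: eqP kI => // ->; rewrite sI.
move=> /memv_imgP[w]; rewrite memv_cap lfunE /= => /andP[wW ws] ew.
exists w; split=> // k kI; have := coord_projE I w k; rewrite -ew kI => <-.
by rewrite mxE eqxx andbT.
Qed.

(* The columns of b indexed by I are the reduced echelon basis of W, the others are standard. *)
Lemma schubert_of_jumps W I : schubert_index I -> \dim W = n ->
  (forall x y, x \in W -> y \in W -> jform x y = 0) ->
  (forall t : 'I_(n + n), jump (flag 1%:M) W t = (t \in I)) ->
  exists2 b, Borel F n b & W = translate b (standard_span F I).
Proof.
move=> hI dW isoW WI.
have [w wP] : exists w : forall s : 'I_(n + n), 'cV[F]_(n + n), forall s, s \in I ->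
    [/\ w s \in W, w s \in flag 1%:M s.+1 & forall k, k \in I -> w s k 0 = (k == s)%:R].
  apply: (@fin_all_exists _ (fun=> 'cV[F]_(n + n)) (fun s w => s \in I ->
    [/\ w \in W, w \in flag 1%:M s.+1 & forall k, k \in I -> w k 0 = (k == s)%:R])) => s.
  case: (boolP (s \in I)) => sI; last by exists 0.
  by have [v vP] := schubert_basis WI sI; exists v.
pose c s : 'cV[F]_(n + n) := if s \in I then w s else delta_mx s 0.
pose b : 'M[F]_(n + n) := \matrix_(i, j) c j i 0.
have colb j : col j b = c j by apply/colP => i; rewrite !mxE.
have tri (i j : 'I_(n + n)) : (j < i)%N -> b i j = 0.
  move=> ji; rewrite mxE /c; case: ifP => jI.
    by have [_ /memv_flag1 -> //] := wP j jI.
  by rewrite mxE -(inj_eq val_inj) /= gtn_eqF.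
have diag i : b i i = 1.
  rewrite mxE /c; case: ifP => iI; last by rewrite mxE !eqxx.
  by have [_ _ ->] := wP i iI; rewrite ?eqxx.
have detb : \det b = 1.
  rewrite -det_tr det_trig.
    by rewrite big1 // => i _; rewrite mxE diag.
  by apply/is_trig_mxP => i j ij; rewrite mxE tri.
have bO : b^T *m antidiag F _ *m b = antidiag F _.
  (* For [j] outside [I], [rev_ord j] is in [I], so the pairing reads a coordinate of [w i] fixed by
     the echelon form. *)
  have mixed (i j : 'I_(n + n)) : i \in I -> j \notin I ->
      jform (w i) (delta_mx j 0) = (j == rev_ord i)%:R.
    move=> iI jI; have [_ _ wi] := wP i iI.
    rewrite jform_sym jform_delta wi ?schubert_rev //.
    by rewrite -(inj_eq rev_ord_inj) rev_ordK.
  apply: jform_mulP => i j; rewrite !colb /c.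
  case: (boolP (i \in I)) => iI; case: (boolP (j \in I)) => jI.
  - have [wi _ _] := wP i iI; have [wj _ _] := wP j jI; rewrite isoW //.
    by case: eqP jI => // ->; rewrite schubert_rev // iI.
  - by rewrite mixed.
  - by rewrite jform_sym mixed // -(inj_eq rev_ord_inj) rev_ordK eq_sym.
  by rewrite jform_delta mxE eqxx andbT eq_sym.
have bSO : SO F n b by split.
have bU := SO_unitmx bSO.
exists b; first by split.
apply/esym/eqP; rewrite eqEdim dim_translate // dim_standard dW.
case: (hI) => -> _ _; rewrite leqnn andbT.
rewrite /translate limg_span; apply/span_subvP => _ /mapP[_ /imageP[i iI ->] ->].
rewrite lfunE /= -colE colb /c iI.
by have [] := wP i iI.
Qed.

Lemma schubert_of_jump_En g I : SO F n g -> schubert_index I ->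
  (forall s, jump (flag (invmx g)) (En F n) s = (s \in I)) ->
  exists2 b, Borel F n b & translate g (En F n) = translate b (standard_span F I).
Proof.
move=> gSO hI gI; have gU := SO_unitmx gSO; apply: schubert_of_jumps => //.
- by rewrite dim_translate // dim_En.
- move=> _ _ /memv_imgP[x xE ->] /memv_imgP[y yE ->]; rewrite !lfunE /=.
  by case: gSO => _ gO; rewrite jform_mul // jform_En.
by move=> t; rewrite -jump_flag_invmx.
Qed.

End Schubert.

(** * Cosets and orbits *)

Section Orbits.
Variables (F : fieldType) (n : nat).
Implicit Types (g h l b : 'M[F]_(n + n)) (c d : {ffun 'I_(n + n) -> symbol}).
Implicit Types (I : {set 'I_(n + n)}).

Lemma SO1 : SO F n 1%:M.
Proof. by split; rewrite ?det1 // trmx1 mul1mx mulmx1. Qed.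

Lemma SO_mul g h : SO F n g -> SO F n h -> SO F n (g *m h).
Proof.
move=> [g1 gO] [h1 hO]; split; first by rewrite det_mulmx g1 h1 mulr1.
by rewrite trmx_mul -!mulmxA (mulmxA g^T) (mulmxA (g^T *m _)) gO mulmxA.
Qed.

Lemma SO_inv g : SO F n g -> SO F n (invmx g).
Proof.
move=> gSO; have gU := SO_unitmx gSO; case: gSO => g1 gO.
split; first by rewrite det_inv g1 invr1.
rewrite -[in LHS]gO trmx_inv !mulmxA mulVmx ?unitmx_tr // mul1mx.
by rewrite -mulmxA mulmxV // mulmx1.
Qed.

Lemma Borel1 : Borel F n 1%:M.
Proof.
split; first exact: SO1.
by move=> i j ji; rewrite mxE -(inj_eq val_inj) /= gtn_eqF.
Qed.

Lemma Parabolic1 : Parabolic F n 1%:M.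
Proof. by split; [exact: SO1 | exact: translate1]. Qed.

Lemma antidiag_block :
  antidiag F (n + n) = block_mx 0 (antidiag F n) (antidiag F n) 0.
Proof.
apply/matrixP => i j; rewrite !mxE; case: splitP => i' ei; rewrite !mxE;
  case: splitP => j' ej; rewrite !mxE -!(inj_eq val_inj) /= ei ej;
  have := ltn_ord i'; have := ltn_ord j' => ? ?.
- by rewrite (_ : (_ == _) = false) //; lia.
- by congr (nat_of_bool _)%:R; lia.
- by congr (nat_of_bool _)%:R; lia.
by rewrite (_ : (_ == _) = false) //; lia.
Qed.

Lemma Levi1 : Levi F n 1%:M.
Proof.
exists 1%:M; first exact: unitmx1.
by rewrite invmx1 trmx1 mulmx1 antidiagK -scalar_mx_block.
Qed.

Lemma Levi_SO l : Levi F n l -> SO F n l.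
Proof.
move=> [A /= AU <-]; split.
  rewrite det_ublock !det_mulmx det_tr det_inv mulrAC det_antidiag_sqr mul1r.
  by rewrite divrr // -unitmxE.
set D := (antidiag F n *m _ *m _).
have D1 : A^T *m antidiag F n *m D = antidiag F n.
  rewrite /D !mulmxA -(mulmxA _ (antidiag F n) (antidiag F n)) antidiagK mulmx1.
  by rewrite -trmx_mul mulVmx // trmx1 mul1mx.
move: D D1 => D D1.
have D2 : D^T *m antidiag F n *m A = antidiag F n.
  by rewrite -[RHS]tr_antidiag -[in RHS]D1 !trmx_mul trmxK tr_antidiag mulmxA.
rewrite antidiag_block tr_block_mx !mulmx_block !trmx0.
by rewrite !(mul0mx, mulmx0, addr0, add0r) D1 D2.
Qed.

Lemma Levi_En l v : Levi F n l -> v \in En F n -> l *m v \in En F n.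
Proof.
move=> [A /= AU <-] /memv_standard v0; apply/memv_standard => k kn.
rewrite mxE big1 // => j _; case: (boolP (j \in initial n n)) => jn; last by rewrite v0 ?mulr0.
rewrite !mxE; case: splitP => k' ek; first by move: kn; rewrite inE ek ltn_ord.
rewrite mxE; case: splitP => j' ej; first by rewrite mxE mul0r.
by move: jn; rewrite inE ej; lia.
Qed.

Lemma Levi_Entilde l v : Levi F n l -> v \in Entilde F n -> l *m v \in Entilde F n.
Proof.
rewrite EntildeE.
move=> [A /= AU <-] /memv_standard_setC v0; apply/memv_standard_setC => k kn.
rewrite mxE big1 // => j _; case: (boolP (j \in initial n n)) => jn; first by rewrite v0 ?mulr0.
rewrite !mxE; case: splitP => k' ek; last by move: kn; rewrite inE ek; lia.
rewrite mxE; case: splitP => j' ej; last by rewrite mxE mul0r.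
by move: jn; rewrite inE ej ltn_ord.
Qed.

Lemma translate_stable l (U : {vspace 'cV[F]_(n + n)}) : l \in unitmx ->
  (forall v, v \in U -> l *m v \in U) -> translate l U = U.
Proof.
move=> lU lstab; apply/eqP; rewrite eqEdim dim_translate // leqnn andbT.
by apply/subvP => _ /memv_imgP[v vU ->]; rewrite lfunE lstab.
Qed.

Lemma translate_Levi_En l : Levi F n l -> translate l (En F n) = En F n.
Proof.
move=> lL; apply: translate_stable => [|v]; last exact: Levi_En.
exact/SO_unitmx/Levi_SO.
Qed.

Lemma translate_Levi_Entilde l : Levi F n l -> translate l (Entilde F n) = Entilde F n.
Proof.
move=> lL; apply: translate_stable => [|v]; last exact: Levi_Entilde.
exact/SO_unitmx/Levi_SO.
Qed.

Lemma pr_Levi l v : Levi F n l -> pr F n (l *m v) = l *m pr F n v.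
Proof.
move=> lL; have e : l *m v = l *m pr F n v + l *m (v - pr F n v).
  by rewrite -mulmxDr addrC subrK.
rewrite e linearD /= pr_id ?Levi_En ?pr_mem //.
have /eqP-> : pr F n (l *m (v - pr F n v)) == 0.
  by rewrite -memv_Entilde Levi_Entilde ?pr_co_mem.
by rewrite addr0.
Qed.

Lemma Levi_Parabolic l : Levi F n l -> Parabolic F n l.
Proof. by move=> lL; split; [exact: Levi_SO | exact: translate_Levi_En]. Qed.

(** An element of L stabilises [En] and [Entilde], hence commutes with the projection, and
    translation by it keeps every dimension. So the conditions on the flag of g^-1 depend only on
    gL. *)
Lemma flag_in_clan_Levi c g l : Levi F n l ->
  flag_in_clan c (flag g) -> flag_in_clan c (flag (l *m g)).
Proof.
move=> lL [hE hT hpr]; have lU := SO_unitmx (Levi_SO lL).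
split=> [i iN | i iN | i j i1 ij jN].
- by rewrite flagM -(translate_Levi_En lL) -translate_cap // dim_translate // hE.
- by rewrite flagM -(translate_Levi_Entilde lL) -translate_cap // dim_translate // hT.
rewrite !flagM -hpr // -[RHS](dim_translate _ lU) translate_add; congr (\dim (_ + _)%VS).
rewrite /translate -!limg_comp; congr lfun_img; apply/lfunP => v.
by rewrite !comp_lfunE !lfunE /= -pr_Levi.
Qed.

(** Right multiplication by [Borel] keeps the flag, so membership of a coset in [orbit_Q] can be
    tested on any representative. *)
Lemma orbit_RP c X : orbit_R F c X <->
  exists g, [/\ SO F n g, left_coset g (Levi F n) = X & flag_in_clan c (flag (invmx g))].
Proof.
split=> [[g [gSO [g' [g'SO cg'] e]] <-] | [g [gSO <- cg]]].
  exists g; split=> //.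
  have : left_coset (invmx g) (Borel F n) (invmx g).
    by exists 1%:M; [exact: Borel1 | rewrite mulmx1].
  rewrite -e => -[b bB <-].
  by case: cg' => h1 h2 h3; split=> *; rewrite !flagM_Borel // (h1, h2, h3).
by exists g => //; split=> //; exists (invmx g) => //; split=> //; exact: SO_inv.
Qed.

Lemma left_coset_Levi_eq g h : left_coset g (Levi F n) = left_coset h (Levi F n) ->
  exists2 l, Levi F n l & h = g *m l.
Proof.
move=> e; have : left_coset h (Levi F n) h.
  by exists 1%:M; [exact: Levi1 | rewrite mulmx1].
by rewrite -e => -[l lL <-]; exists l.
Qed.

(** [Parabolic] stabilises [En], so [translate g En] depends only on the coset gP, and gL lies in
    gP. *)
Lemma proj_LP_schubert g I : SO F n g ->
  schubert_cell F I (proj_LP F n (left_coset g (Levi F n))) <->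
  exists2 b, Borel F n b & translate g (En F n) = translate b (standard_span F I).
Proof.
move=> gSO; split=> [[g1 [g1SO [b bB g1E]] e] | [b bB gE]].
  exists b => //; rewrite -g1E.
  have : left_coset g1 (Parabolic F n) g1.
    by exists 1%:M; [exact: Parabolic1 | rewrite mulmx1].
  rewrite e => -[_ [l lL <-] [q [_ qE] <-]].
  by rewrite !translateM qE (translate_Levi_En lL).
exists g; first by split=> //; exists b.
apply/classical_sets.seteqP; split=> [_ [q qP <-] | _ [_ [l lL <-] [q [qSO qE] <-]]].
  exists g; first by exists 1%:M; [exact: Levi1 | rewrite mulmx1].
  by exists q.
exists (l *m q); last by rewrite mulmxA.
have [lSO lE] := Levi_Parabolic lL.
by split; [exact: SO_mul | rewrite translateM qE lE].
Qed.

Lemma flag_in_clan_clan_of_flag g : g \in unitmx ->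
  flag_in_clan (clan_of_flag (flag g) n (pr F n) (En F n) (Entilde F n)) (flag g).
Proof.
move=> gU; have V_sub := @flag_sub F n g; have dimV i := @dim_flag F n g i gU.
have idem := @pr_idem F n; have memE := @memv_En F n; have memT := @memv_Entilde F n.
split=> [i /andP[_ iN] | i /andP[_ iN] | i j _ ij jN].
- by rewrite nb_plus_clan_of_flag.
- by rewrite nb_minus_clan_of_flag.
by rewrite -nb_spanning_clan_of_flag ?flag_full // ltnW.
Qed.

(** Stated for any clan whose numbers fit the flag, not only for [clan_of_flag], so that it serves
    both inclusions. *)
Lemma base_clan_flag c g I : g \in unitmx -> is_clan c -> flag_in_clan c (flag g) ->
  base_clan c = clan_of_index I <->
  (forall s : 'I_(n + n), jump (flag g) (En F n) s = (s \in I)).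
Proof.
move=> gU cl [hE _ _]; rewrite base_clanP //.
have e : forall s, ((c s == SPlus) + right_end c s)%N = jump (flag g) (En F n) s.
  apply: prefix_sum_inj => i /[dup] iN1 /andP[_ iN].
  rewrite -nb_plus_completedE // -hE //.
  rewrite (dim_jumps (@flag_sub F n g) (fun j => dim_flag gU) _ iN).
  by rewrite (big_ord_widen _ (fun s => jump (flag g) (En F n) s : nat) iN).
by split=> H s; have := H s; rewrite e; case: jump; case: (s \in I).
Qed.

End Orbits.

(* The fibre over a Schubert cell *)
From mathcomp Require Import classical_sets reals.
Local Open Scope classical_set_scope.

Theorem theorem3p10 (R : realType) (n : nat) (hn : (1 <= n)%N)
    (I : {set 'I_(n + n)}) (hI : schubert_index I) :
  quotient_SO (Levi R[i] n) `&` (proj_LP R[i] n @^-1` schubert_cell R[i] I)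
    = \bigcup_(c in Sigma I) orbit_R R[i] c
  /\ forall c d : {ffun 'I_(n + n) -> symbol}, Sigma I c -> Sigma I d ->
       ~ clan_eq c d -> orbit_R R[i] c `&` orbit_R R[i] d = set0.
Proof.
have two : 2%:R != 0 :> R[i] by rewrite pnatr_eq0.
split.
  apply/seteqP; split=> [_ [[g gSO <-]] | X [c [cD cI] /orbit_RP[g [gSO <- cg]]]].
    have hSO := SO_inv gSO; have hU := SO_unitmx hSO; have [h1 hO] := hSO.
    move=> /(proj_LP_schubert _ gSO)[b bB gE].
    set c := clan_of_flag (flag (invmx g)) n (pr R[i] n) (En R[i] n) (Entilde R[i] n).
    have cD : is_DIII c by apply: is_DIII_clan_of_flag; rewrite ?even_cap_Entilde.
    have ch := flag_in_clan_clan_of_flag hU.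
    exists c; last by apply/orbit_RP; exists g.
    split=> //; have [cl _ _ _] := cD.
    by apply/(base_clan_flag _ hU cl ch) => s; exact: jump_schubert bB gE.
  split; first by exists g.
  apply/(proj_LP_schubert _ gSO)/schubert_of_jump_En => // s.
  have [cl _ _ _] := cD.
  exact: (proj1 (base_clan_flag I (SO_unitmx (SO_inv gSO)) cl cg) cI s).
move=> c d [[clc _ _ _] _] [[cld _ _ _] _] ncd.
(* Representatives [g] and [h] of a common coset differ by an element of L, so both clans can be
   tested on the flag of [invmx h]; equal dimensions then give equal clans. *)
rewrite -subset0 => X [/orbit_RP[g [gSO <- cg]] /orbit_RP[h [hSO e dh]]].
apply: ncd; have [l lL gE] := left_coset_Levi_eq e.
have lU := SO_unitmx (Levi_SO lL); have hU := SO_unitmx hSO.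
have gU := SO_unitmx gSO.
have {}cg : flag_in_clan c (flag (invmx h)).
  have -> : invmx h = l *m invmx g.
    by apply: (can_inj (mulmxK gU)); rewrite mulmxKV // gE mulKmx.
  exact: flag_in_clan_Levi cg.
case: cg => hE hT hpr; case: dh => hE' hT' hpr'.
apply: clan_eq_of_counts => // [i iN | i iN | i j i1 ij jN].
- by rewrite -hE // hE'.
- by rewrite -hT // hT'.
by apply: (@addnI j); rewrite -hpr // hpr'.
Qed.
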